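(* Let $\mathfrak{g}$ be a two-step nilpotent Lie group with the Campbell-Hausdorff multiplication $x\circ y=x+y+\frac12[x,y]$, of dimension $d$. If $\alpha\in\mathbb{N}^d$ and $f,g\in\mathcal{S}(\mathfrak{g}^* )$, then $$D^{\alpha}(f\# g)=\sum_{\beta+\gamma+\sigma_{[0]}=\alpha}\binom{\alpha}{\beta}_{\sigma}\,c_{\sigma}\;D^{\beta+\sigma_{[1]}}f\,\#\,D^{\gamma+\sigma_{[2]}}g,$$ where the sum runs over all $\beta,\gamma\in\mathbb{N}^d$ and $\sigma\in\mathbb{N}^{\mathcal D}$ with $\beta+\gamma+\sigma_{[0]}=\alpha$, and $$c_{\sigma}=2^{-\sum_{(i,j,k)\in \mathcal D}\sigma_{(i,j,k)}}\prod_{(i,j,k)\in \mathcal D}a_{i,j,k}^{\sigma_{(i,j,k)}}.$$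
   Context: $\mathbb{N}$ contains $0$. $\mathfrak{g}$ is a real two-step nilpotent Lie algebra of dimension $d$, endowed with dilations $(\delta_t)_{t>0}$ (one-parameter group of automorphisms) with exponents of homogeneity $1,2$, i.e. $\mathfrak{g}=\mathfrak{g}_1\oplus\mathfrak{g}_2$ with $\mathfrak{g}_j=\{x:\delta_t(x)=t^jx \text{ for all } t>0\}$. The vector space $\mathfrak{g}$ is also a Lie group with multiplication $x\circ y=x+y+\frac12[x,y]$ (so $y^{-1}=-y$). Fix a basis $X_1,\dots,X_d$ of $\mathfrak{g}$, write $x=\sum_i x_iX_i$, use the dual basis for coordinates on $\mathfrak{g}^*$, and define structure constants by $[X_i,X_j]=\sum_{k=1}^d a_{i,j,k}X_k$. Convolution on $\mathfrak{g}$ is $f*g(x)=\int_{\mathfrak{g}}f(x\circ y^{-1})g(y)\,dy$. Lebesgue measures $dx,d\xi$ on $\mathfrak{g},\mathfrak{g}^*$ are normalized so that the Abelian Fourier transform and its inverse are $\widehat f(\xi)=\int_{\mathfrak{g}}e^{-ix\xi}f(x)\,dx$ and $f^\vee(x)=\int_{\mathfrak{g}^*}e^{ix\xi}f(\xi)\,d\xi$, where $x\xi$ is the duality pairing. For $f,g\in\mathcal{S}(\mathfrak{g}^* )$ (Schwartz space), $f\# g=(f^\vee*g^\vee)^\wedge\in\mathcal{S}(\mathfrak{g}^* )$. Derivatives: $D_jf=i\,\partial_jf$ (with $i=\sqrt{-1}$) and $D^\alpha=D_1^{\alpha_1}\cdots D_d^{\alpha_d}$. Let $\mathcal D=\{(i,j,k):a_{i,j,k}\neq0\}$.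 For $\sigma\in\mathbb{N}^{\mathcal D}$ the multiindices $\sigma_{[0]},\sigma_{[1]},\sigma_{[2]}\in\mathbb{N}^d$ are $\sigma_{[0],k}=\sum_{i,j}\sigma_{(i,j,k)}$, $\sigma_{[1],i}=\sum_{j,k}\sigma_{(i,j,k)}$, $\sigma_{[2],j}=\sum_{i,k}\sigma_{(i,j,k)}$ (sums over triples in $\mathcal D$). For $\beta+\sigma_{[0]}\le\alpha$, $\binom{\alpha}{\beta}_\sigma=\frac{\alpha!}{\beta!\,\sigma!\,(\alpha-\beta-\sigma_{[0]})!}$, where factorials of multiindices are products of the factorials of their entries. *)

(* Defs.v *)
From HB Require Import structures.
From mathcomp Require Import all_boot all_order all_algebra complex.
From mathcomp Require Import all_classical all_reals all_analysis.

Set Implicit Arguments.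
Unset Strict Implicit.
Unset Printing Implicit Defensive.
Import Order.TTheory GRing.Theory Num.Theory numFieldNormedType.Exports.
Local Open Scope classical_set_scope.
Local Open Scope ring_scope.
Local Open Scope complex_scope.

(** Lebesgue measure on R^n, carried by n-tuples (whose sigma-algebra is
    generated by the coordinates): the point mass for n = 0, and in dimension
    n + 1 the image of (Lebesgue measure on R) x (Lebesgue measure on R^n)
    under (x, t) |-> x :: t. *)
Section LebesgueTuple.
Context (R : realType).
Local Notation T := (measurableTypeR R).

Definition tcons n (p : T * n.-tuple T) : n.+1.-tuple T :=
  [the n.+1.-tuple T of p.1 :: p.2].

Lemma measurable_tcons n : measurable_fun [set: T * n.-tuple T] (@tcons n).
Proof. exact: measurable_cons measurable_fst measurable_snd. Qed.

Section Step.
Variables (n : nat) (mu : {sigma_finite_measure set (n.-tuple T) -> \bar R}).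

Definition lebesgue_tuple_succ : set (n.+1.-tuple T) -> \bar R :=
  pushforward (@lebesgue_measure R \x mu)%E (@tcons n).

Let mu0 : lebesgue_tuple_succ set0 = 0%E.
Proof. by rewrite /lebesgue_tuple_succ /pushforward preimage_set0 measure0. Qed.

Let mu_ge0 A : (0 <= lebesgue_tuple_succ A)%E.
Proof. by rewrite /lebesgue_tuple_succ /pushforward measure_ge0. Qed.

Let mu_sigma_additive : semi_sigma_additive lebesgue_tuple_succ.
Proof.
move=> F mF tF mUF; rewrite /lebesgue_tuple_succ /pushforward preimage_bigcup.
apply: measure_semi_sigma_additive.
- by move=> k; rewrite -[X in measurable X]setTI; exact: measurable_tcons.
- apply/trivIsetP => /= i j _ _ ij; rewrite -preimage_setI.
  by move/trivIsetP : tF => /(_ _ _ _ _ ij) ->//; rewrite preimage_set0.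
- rewrite -preimage_bigcup -[X in measurable X]setTI.
  exact: measurable_tcons.
Qed.

HB.instance Definition _ := isMeasure.Build _ _ _
  lebesgue_tuple_succ mu0 mu_ge0 mu_sigma_additive.

Let mu_sigma_finite : sigma_finite setT lebesgue_tuple_succ.
Proof.
have /sigma_finiteP[F [UF ndF Foo]] := sigma_finiteT (@lebesgue_measure R).
have /sigma_finiteP[G [UG ndG Goo]] := sigma_finiteT mu.
pose u (t : n.+1.-tuple T) : T * n.-tuple T := (thead t, [tuple of behead t]).
have uK p : u (tcons p) = p.
  by case: p => x t; rewrite /u theadE; congr pair; exact: val_inj.
have um : measurable_fun [set: n.+1.-tuple T] u.
  apply/measurable_fun_pairP; split; first exact: measurable_tnth.
  exact: measurable_behead.
exists (fun k => u @^-1` (F k `*` G k)).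
  apply/seteqP; split => // t _.
  have [i _ Fi] : (\bigcup_k F k) (thead t) by rewrite -UF.
  have [j _ Gj] : (\bigcup_k G k) [tuple of behead t] by rewrite -UG.
  exists (maxn i j) => //; split => /=.
  - by move: Fi; exact/subsetPset/ndF/leq_maxl.
  - by move: Gj; exact/subsetPset/ndG/leq_maxr.
move=> k; have [mF Fk] := Foo k; have [mG Gk] := Goo k; split.
  by rewrite -[X in measurable X]setTI; apply: um => //; exact: measurableX.
rewrite /lebesgue_tuple_succ /pushforward.
suff -> : @tcons n @^-1` (u @^-1` (F k `*` G k)) = F k `*` G k.
  by rewrite product_measure1E// lte_mul_pinfty// ge0_fin_numE.
by rewrite -comp_preimage (_ : u \o _ = id)//; exact/funext.
Qed.

HB.instance Definition _ := Measure_isSigmaFinite.Build _ _ _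
  lebesgue_tuple_succ mu_sigma_finite.

End Step.

Fixpoint lebesgue_tuple n : {sigma_finite_measure set (n.-tuple T) -> \bar R} :=
  match n with
  | 0 => [the {sigma_finite_measure set (0.-tuple T) -> \bar R}
            of \d_([tuple] : 0.-tuple T)]
  | n'.+1 => [the {sigma_finite_measure set (n'.+1.-tuple T) -> \bar R}
            of lebesgue_tuple_succ (lebesgue_tuple n')]
  end.

(** Complex-valued Lebesgue integral over R^n of a function of a row vector. *)
Definition cintegral n (F : 'rV[R]_n -> R[i]) : R[i] :=
  Rintegral (lebesgue_tuple n) setT (fun t => complex.Re (F (\row_i tnth t i)))
  +i* Rintegral (lebesgue_tuple n) setT (fun t => complex.Im (F (\row_i tnth t i))).

Definition cexpi (r : R) : R[i] := cos r +i* sin r.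

End LebesgueTuple.

Section LieAlgebra.
Context (R : realType) (g : vectType R).
Implicit Types (br : g -> g -> g) (delta : R -> 'End(g)).

Definition lie_bracket br : Prop :=
  [/\ forall x, linear (br x),
      forall y, linear (br^~ y),
      forall x, br x x = 0
    & forall x y z, br x (br y z) + br y (br z x) + br z (br x y) = 0].

(** Nilpotency class at most two: the abelian case is allowed. *)
Definition two_step br : Prop := forall x y z, br x (br y z) = 0.

Definition homogeneous delta (j : nat) (V : {vspace g}) : Prop :=
  forall x, x \in V <-> (forall t, 0 < t -> delta t x = t ^+ j *: x).

(** One-parameter group (delta_t)_(t > 0) of automorphisms with exponents of
    homogeneity 1 and 2; the values of delta at t <= 0 are irrelevant. *)
Definition two_step_dilations br delta : Prop :=
  [/\ delta 1 = \1%VF,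
      forall s t, 0 < s -> 0 < t -> delta (s * t) = (delta s \o delta t)%VF,
      forall t x y, 0 < t -> delta t (br x y) = br (delta t x) (delta t y)
    & exists g1 g2 : {vspace g},
        [/\ homogeneous delta 1 g1, homogeneous delta 2 g2,
            (g1 + g2)%VS = fullv & (g1 :&: g2)%VS = 0%VS]].

Definition ch_mul br (x y : g) : g := x + y + 2^-1 *: br x y.

End LieAlgebra.

Section Coordinates.
Context (R : realType) (g : vectType R) (d : nat) (X : d.-tuple g).

Definition dual := 'Hom(g, R^o).

Definition point (v : 'rV[R]_d) : g := \sum_i v 0 i *: tnth X i.

Definition dual_basis (i : 'I_d) : dual := linfun (coord X i : g -> R^o).

Definition covector (v : 'rV[R]_d) : dual := \sum_i v 0 i *: dual_basis i.

(** Coordinates of a covector in the dual basis. *)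
Definition dual_coord (xi : dual) : 'rV[R]_d := \row_i (xi (tnth X i) : R).

Definition struct_const (br : g -> g -> g) (i j k : 'I_d) : R :=
  coord X k (br (tnth X i) (tnth X j)).

(** Partial derivatives of complex functions on the dual space, with respect to
    the coordinates in the dual basis. *)
Definition partial (j : 'I_d) (f : dual -> R[i]) (xi : dual) : R[i] :=
  'D_(delta_mx 0 j) (fun v : 'rV[R]_d => complex.Re (f (covector v)) : R)
     (dual_coord xi)
  +i* 'D_(delta_mx 0 j) (fun v : 'rV[R]_d => complex.Im (f (covector v)) : R)
     (dual_coord xi).

Definition Dpart (j : 'I_d) (f : dual -> R[i]) (xi : dual) : R[i] :=
  'i * partial j f xi.

Definition multi_iter (op : 'I_d -> (dual -> R[i]) -> (dual -> R[i]))
    (a : {ffun 'I_d -> nat}) (f : dual -> R[i]) : dual -> R[i] :=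
  foldr (fun j => iter (a j) (op j)) f (enum 'I_d).

Definition Dmulti := multi_iter Dpart.

(** Smoothness: iterated partial derivatives, in any order, are (Frechet)
    differentiable everywhere. *)
Definition smooth (f : dual -> R[i]) : Prop :=
  forall (s : seq 'I_d) (v : 'rV[R]_d),
    differentiable
      (fun w : 'rV[R]_d => complex.Re (foldr partial f s (covector w)) : R) v /\
    differentiable
      (fun w : 'rV[R]_d => complex.Im (foldr partial f s (covector w)) : R) v.

Definition schwartz (f : dual -> R[i]) : Prop :=
  smooth f /\
  forall a b : {ffun 'I_d -> nat}, exists M : R, forall xi : dual,
    `| (\prod_i dual_coord xi 0 i ^+ a i)%:C * multi_iter partial b f xi |
      <= M%:C.

(** The Lebesgue measures on g and its dual are cx and cxi times the Lebesgue
    measures in the coordinates. *)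
Definition integral_alg (cx : R) (F : g -> R[i]) : R[i] :=
  cx%:C * cintegral (fun v => F (point v)).

Definition integral_dual (cxi : R) (F : dual -> R[i]) : R[i] :=
  cxi%:C * cintegral (fun v => F (covector v)).

Definition fourier (cx : R) (f : g -> R[i]) (xi : dual) : R[i] :=
  integral_alg cx (fun x => cexpi (- (xi x : R)) * f x).

Definition inv_fourier (cxi : R) (f : dual -> R[i]) (x : g) : R[i] :=
  integral_dual cxi (fun xi => cexpi (xi x : R) * f xi).

Definition convolution (br : g -> g -> g) (cx : R) (f h : g -> R[i]) (x : g) :
    R[i] :=
  integral_alg cx (fun y => f (ch_mul br x (- y)) * h y).

Definition sharp (br : g -> g -> g) (cx cxi : R) (f h : dual -> R[i]) :
    dual -> R[i] :=
  fourier cx (convolution br cx (inv_fourier cxi f) (inv_fourier cxi h)).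

End Coordinates.

Section Combinatorics.
Context (R : realType) (g : vectType R) (d : nat) (X : d.-tuple g).
Variable br : g -> g -> g.
Local Notation multi := {ffun 'I_d -> nat}.

(** The set of triples (i, j, k), encoded as ((i, j), k), with nonzero
    structure constant. *)
Definition triples :=
  {t : 'I_d * 'I_d * 'I_d | struct_const X br t.1.1 t.1.2 t.2 != 0}.

Implicit Type s : {ffun triples -> nat}.

Definition sigma0 s : multi :=
  [ffun k => (\sum_(t : triples | (val t).2 == k) s t)%N].
Definition sigma1 s : multi :=
  [ffun i => (\sum_(t : triples | (val t).1.1 == i) s t)%N].
Definition sigma2 s : multi :=
  [ffun j => (\sum_(t : triples | (val t).1.2 == j) s t)%N].

Definition multi_fact (I : finType) (a : {ffun I -> nat}) : nat :=
  (\prod_i (a i)`!)%N.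

(** Only used when b + sigma0 s <= a, where the truncated subtraction is the
    genuine one. *)
Definition multi_binom (a b : multi) s : R :=
  (multi_fact a)%:R /
  (multi_fact b * multi_fact s *
   multi_fact [ffun k => (a k - b k - sigma0 s k)%N])%:R.

Definition c_sigma s : R :=
  2 ^- (\sum_(t : triples) s t)%N *
  \prod_(t : triples)
     struct_const X br (val t).1.1 (val t).1.2 (val t).2 ^+ s t.

(** Triples (beta, gamma, sigma) with beta + gamma + sigma_[0] = a; this set is
    finite. *)
Definition decompositions (a : multi) :
    set (multi * multi * {ffun triples -> nat}) :=
  [set p | p.1.1 + p.1.2 + sigma0 p.2 = a].

End Combinatorics.

(* Main.v *)
Require Import Defs.
From HB Require Import structures.
From mathcomp Require Import all_boot all_order all_algebra complex.
From mathcomp Require Import all_classical all_reals all_analysis.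
From mathcomp Require Import measurable_realfun ring lra.

Set Implicit Arguments.
Unset Strict Implicit.
Unset Printing Implicit Defensive.
Import Order.TTheory GRing.Theory Num.Theory numFieldNormedType.Exports.
Local Open Scope classical_set_scope.
Local Open Scope ring_scope.
Local Open Scope complex_scope.


(** Under the Fourier transform D^a corresponds to multiplication by x^a, on
    both sides.  Writing F and H for the inverse transforms of f and h, the
    function D^alpha (f # h) is therefore the transform of x^alpha times the
    convolution of F and H, and the theorem becomes an identity between
    convolutions on the group.

    In the integral of F (x o y^-1) H y over y, put z = x o y^-1.  Two-step
    nilpotency gives x = z o y, that is
      x_k = z_k + y_k + sum over i, j of a_{i,j,k} z_i y_j / 2.
    Expanding x^alpha by the multinomial theorem, with one variable for each
    z_k, each y_k and each triple of D, produces exactly the monomials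
    z^(beta + sigma_[1]) y^(gamma + sigma_[2]) with the coefficients of the
    statement ([monomial_ch_mul], from [multinomial_coloured]).  The factors
    z^b and y^c are absorbed by F and H, and z^b F is the inverse transform of
    D^b f ([ftransform_Dmulti]); this is [monomial_coord_conv].

    The analysis takes place in the class [crapid] of measurable functions that
    remain bounded after multiplication by any monomial.  Such functions are
    dominated by the product of the 1 / (1 + x_i^2), hence integrable
    ([integrable_weight]), so that integrals may be differentiated under the
    integral sign ([is_derive_ftransform]).  Integration by parts
    ([ftransform_partial]) reduces to the vanishing of the integral of a partial
    derivative ([integral_partial_eq0]), which follows from the one-dimensional
    case by Fubini's theorem.  Convolutions stay in the class because the
    expansion above writes x^a times a convolution as a finite sum of
    convolutions, each of them bounded ([crapid_coord_conv]).  The iterated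
    derivatives of f are transformed one letter at a time, in the order fixed by
    [Dmulti]; the order disappears once they have become multiplications by
    coordinates. *)

(** * Multinomial expansion with coloured variables *)

Lemma multiD (J : finType) (a b : {ffun J -> nat}) j :
  (a + b) j = (a j + b j)%N.
Proof. by rewrite ffunE. Qed.

(** Divided powers x^n / n! satisfy a recurrence without binomial coefficients,
    which is why the multinomial theorem is proved for them. *)
Lemma divpowS (F : numFieldType) (x : F) n :
  x ^+ n.+1 / n.+1`!%:R * n.+1%:R = x * (x ^+ n / n`!%:R).
Proof.
rewrite exprS factS natrM; field.
by rewrite -(natrD _ 1 n) !pnatr_eq0 -!lt0n fact_gt0.
Qed.

Section ColouredMultinomial.
Context (F : numFieldType) (I K : finType) (c : I -> K) (u : I -> F).

(** The exponents of the monomials occurring in the product over the colours k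
    of the a_k-th power of the sum of the variables of colour k. *)
Definition coloured (a : {ffun K -> nat}) : set {ffun I -> nat} :=
  [set m | forall k, (\sum_(s | c s == k) m s)%N = a k].

Definition divpow (m : {ffun I -> nat}) : F :=
  \prod_s (u s ^+ m s / (m s)`!%:R).

Definition unit_multi (J : finType) (j : J) : {ffun J -> nat} :=
  [ffun i => nat_of_bool (i == j)].

Lemma coloured_finite a : finite_set (coloured a).
Proof.
pose N := (\sum_k a k)%N.
apply: (@sub_finite_set _ _
  ((fun m : {ffun I -> 'I_N.+1} => [ffun i => m i : nat]) @` setT)).
  move=> m am; have mN i : (m i < N.+1)%N.
    rewrite ltnS /N (bigD1 (c i))//= -am (bigD1 i)//= -addnA; exact: leq_addr.
  exists [ffun i => Ordinal (mN i)] => //.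
  by apply/ffunP => i; rewrite !ffunE.
exact/finite_image/finite_finset.
Qed.

(** In each term a_k + 1 is the sum of the exponents of the variables s of
    colour k, and m_s u^m / m! is u_s times the divided power of m with the
    exponent of s lowered by one. *)
Lemma sum_divpow_rec a k :
  (\sum_(m \in coloured (a + unit_multi k)) divpow m) * (a k).+1%:R =
  (\sum_(s | c s == k) u s) * \sum_(m \in coloured a) divpow m.
Proof.
transitivity
    (\sum_(s | c s == k) \sum_(m \in coloured (a + unit_multi k)) divpow m * (m s)%:R).
  rewrite [in LHS]fsbig_finite; last exact: coloured_finite.
  rewrite mulr_suml.
  under [RHS]eq_bigr => s _.
    rewrite fsbig_finite; last exact: coloured_finite.
    over.
  rewrite exchange_big/= big_seq [RHS]big_seq; apply: eq_bigr => m.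
  rewrite in_fset_set ?inE; last exact: coloured_finite.
  move=> /(_ k); rewrite multiD ffunE eqxx addn1 => <-.
  by rewrite natr_sum mulr_sumr.
rewrite mulr_suml; apply: eq_bigr => s /eqP csk.
transitivity (\sum_(m \in coloured a) u s * divpow m); last first.
  by rewrite -mulr_fsumr.
have uE (m : {ffun I -> nat}) i : (m + unit_multi s) i = (m i + (i == s))%N.
  by rewrite multiD ffunE.
rewrite -(@fsbig_widen _ _ _ _ [set m | coloured (a + unit_multi k) m /\ m s != 0%N]);
  first last.
- move=> m [/= am /not_andP[//|/negP]]; rewrite negbK => /eqP ->.
  by rewrite mulr0.
- by move=> m [].
rewrite (@reindex_fsbig _ _ _ _ _ (fun m => m + unit_multi s) (coloured a)); last first.
  split.
  - move=> m am; split; last by rewrite uE eqxx addn1.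
    move=> l; under eq_bigr do rewrite uE.
    rewrite big_split/= am multiD ffunE; congr addn.
    rewrite -csk big_mkcond (bigD1 s)//= big1 ?addn0.
      by rewrite eqxx eq_sym; case: eqP.
    by move=> i /negPf ->; case: eqP.
  - move=> m1 m2 _ _ /ffunP e; apply/ffunP => i; have := e i.
    by rewrite !uE => /addIn.
  - move=> m [am ms]; exists [ffun i => (m i - (i == s))%N].
      move=> l; have := am l; rewrite multiD ffunE.
      under [in X in _ -> X]eq_bigr do rewrite ffunE.
      rewrite -csk; have [ls|ls] := eqVneq l (c s).
        subst l; rewrite (bigD1 s)//= [in X in _ -> X](bigD1 s)//= eqxx.
        under [in X in _ -> X]eq_bigr => i /andP[_ /negPf ->] do rewrite subn0.
        by case: (m s) ms => // n _; rewrite subn1/= addSn addn1 => -[].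
      rewrite addn0 => <-; apply: eq_bigr => i /eqP il.
      by case: eqP => [si|]; rewrite ?subn0//; rewrite -il si eqxx in ls.
    apply/ffunP => i; rewrite multiD !ffunE subnK//.
    by case: eqP => [->|//]; rewrite lt0n.
apply: eq_fsbigr => m _; rewrite /divpow.
rewrite (bigD1 s)//= [in RHS](bigD1 s)//= uE eqxx addn1.
under eq_bigr => i /negPf si do rewrite uE si addn0.
by rewrite mulrAC divpowS -!mulrA.
Qed.

(** Divided by a!, the multinomial theorem says that divided powers of sums are
    sums of divided powers; induction on the total degree of a. *)
Lemma multinomial_coloured (a : {ffun K -> nat}) :
  \prod_k ((\sum_(s | c s == k) u s) ^+ a k / (a k)`!%:R) =
  \sum_(m \in coloured a) divpow m.
Proof.
have [N] := ubnP (\sum_k a k)%N; elim: N a => // N IH a aN.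
have [/existsP[k ak]|] := boolP [exists k, a k != 0%N]; last first.
  rewrite negb_exists => /forallP a0; have {}a0 k : a k = 0%N.
    by have := a0 k; rewrite negbK => /eqP.
  rewrite big1; last by move=> k _; rewrite a0 expr0 divr1.
  rewrite (_ : coloured a = [set 0]).
    by rewrite fsbig_set1 /divpow big1// => s _; rewrite ffunE expr0 divr1.
  apply/seteqP; split=> m /=.
    move=> am; apply/ffunP => s; have := am (c s).
    rewrite a0 (bigD1 s)//= ffunE; by case: (m s).
  by move=> -> k; rewrite a0 big1// => i _; rewrite ffunE.
(* b is a with one factor of colour k removed *)
pose b := [ffun i => (a i - (i == k))%N].
have ab : a = b + unit_multi k.
  apply/ffunP => i; rewrite multiD !ffunE subnK//.
  by case: eqP => [->|//]; rewrite lt0n.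
have abk : a k = (b k).+1 by rewrite {1}ab multiD [unit_multi _ _]ffunE eqxx addn1.
have abi i : i != k -> a i = b i.
  by rewrite ab multiD [unit_multi _ _]ffunE => /negPf ->; rewrite addn0.
have bN : (\sum_k b k < N)%N.
  move: aN; rewrite (bigD1 k)//= abk addSn ltnS; apply: leq_trans.
  rewrite ltnS (bigD1 k)//= leq_add2l; apply: leq_sum => i ik.
  by rewrite abi.
have := sum_divpow_rec b k; rewrite -ab -(IH _ bN) => e.
apply: (@mulIf _ (b k).+1%:R); first by rewrite pnatr_eq0.
rewrite e (bigD1 k)//= [in RHS](bigD1 k)//= abk.
under [X in _ * X * _]eq_bigr => i ik do rewrite abi//.
by rewrite mulrAC divpowS -!mulrA.
Qed.

End ColouredMultinomial.

Section Decomposition.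
Context (R : realType) (g : vectType R) (d : nat) (X : d.-tuple g).
Context (br : g -> g -> g).
Local Notation multi := {ffun 'I_d -> nat}.
Local Notation triples := (triples X br).
Local Notation a_ t := (struct_const X br (val t).1.1 (val t).1.2 (val t).2).

Definition monomial (v : 'rV[R]_d) (a : multi) : R := \prod_i v 0 i ^+ a i.

Lemma monomialD v a b : monomial v (a + b) = monomial v a * monomial v b.
Proof.
by rewrite /monomial -big_split; apply: eq_bigr => i _; rewrite multiD exprD.
Qed.

(** This is how sigma_[1] and sigma_[2] enter: a product over triples becomes a
    monomial whose exponents are the sums of sigma over the fibres. *)
Lemma monomial_fibre (T : finType) (h : T -> 'I_d) (s : {ffun T -> nat}) v :
  monomial v [ffun i => (\sum_(t | h t == i) s t)%N] =
  \prod_t v 0 (h t) ^+ s t.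
Proof.
rewrite (partition_big h xpredT)//=; apply: eq_bigr => i _.
rewrite ffunE -prodrXr; by apply: eq_bigr => t /eqP ->.
Qed.

(** Expanding x_k = z_k + y_k + ... involves a variable z_k, a variable y_k and
    one variable for each triple with last entry k; k is their colour. *)
Definition split_index (s : 'I_d + 'I_d + triples) : 'I_d :=
  match s with inl (inl i) => i | inl (inr i) => i | inr t => (val t).2 end.

Definition join_multi (p : multi * multi * {ffun triples -> nat}) :
    {ffun 'I_d + 'I_d + triples -> nat} :=
  [ffun s => match s with
             | inl (inl i) => p.1.1 i | inl (inr i) => p.1.2 i | inr t => p.2 t
             end].

Lemma big_split_index (S : Type) (idx : S) (op : Monoid.com_law idx)
    (P : pred ('I_d + 'I_d + triples)) (f : 'I_d + 'I_d + triples -> S) :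
  \big[op/idx]_(s | P s) f s =
  op (op (\big[op/idx]_(i | P (inl (inl i))) f (inl (inl i)))
         (\big[op/idx]_(i | P (inl (inr i))) f (inl (inr i))))
     (\big[op/idx]_(t | P (inr t)) f (inr t)).
Proof. by rewrite !big_sumType. Qed.

(** A multiindex on the three kinds of variables is a triple (beta, gamma,
    sigma); having colour sums a means beta + gamma + sigma_[0] = a. *)
Lemma join_multi_bij a :
  set_bij (@decompositions R g d X br a) (coloured split_index a) join_multi.
Proof.
have sumE m k : (\sum_(s | split_index s == k) m s)%N =
    (m (inl (inl k)) + m (inl (inr k)) +
     \sum_(t : triples | (val t).2 == k) m (inr t))%N.
  by rewrite big_split_index/= !big_pred1_eq.
split.
- move=> [[b c] s] /= <- k; rewrite sumE !ffunE; congr addn.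
  by apply: eq_bigr => t _; rewrite ffunE.
- move=> [[b1 c1] s1] [[b2 c2] s2] _ _ /ffunP e.
  have eb : b1 = b2 by apply/ffunP => i; have := e (inl (inl i)); rewrite !ffunE.
  have ec : c1 = c2 by apply/ffunP => i; have := e (inl (inr i)); rewrite !ffunE.
  have es : s1 = s2 by apply/ffunP => t; have := e (inr t); rewrite !ffunE.
  by rewrite eb ec es.
- move=> m am; exists ([ffun i => m (inl (inl i))], [ffun i => m (inl (inr i))],
    [ffun t => m (inr t)]) => /=.
    apply/ffunP => k; rewrite -(am k) sumE !ffunE; congr addn.
    by apply: eq_bigr => t _; rewrite ffunE.
  by apply/ffunP => -[[i|i]|t]; rewrite !ffunE.
Qed.

Lemma decompositions_finite a : finite_set (@decompositions R g d X br a).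
Proof.
pose split_multi (m : {ffun 'I_d + 'I_d + triples -> nat}) :=
  ([ffun i => m (inl (inl i))] : multi, [ffun i => m (inl (inr i))] : multi,
   [ffun t => m (inr t)] : {ffun triples -> nat}).
have [joinP _ _] := join_multi_bij a.
apply: (@sub_finite_set _ _ (split_multi @` coloured split_index a)).
  move=> [[b c] s] pa; exists (join_multi (b, c, s)); first exact: joinP.
  by rewrite /split_multi; congr (_, _, _); apply/ffunP => i; rewrite !ffunE.
exact/finite_image/coloured_finite.
Qed.

(** The algebraic core of the theorem: the coefficients of the twisted Leibniz
    rule are those of the expansion of a monomial in the coordinates of the
    product z o y. *)
Lemma monomial_ch_mul a (x y z : 'rV[R]_d) :
  (forall k, x 0 k = z 0 k + y 0 k +
    \sum_(t : triples | (val t).2 == k)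
      2^-1 * a_ t * (z 0 (val t).1.1 * y 0 (val t).1.2)) ->
  monomial x a = \sum_(p \in @decompositions R g d X br a)
    multi_binom a p.1.1 p.2 * c_sigma p.2 *
    (monomial z (p.1.1 + sigma1 p.2) * monomial y (p.1.2 + sigma2 p.2)).
Proof.
move=> xE.
pose u (s : 'I_d + 'I_d + triples) : R := match s with
  | inl (inl i) => z 0 i | inl (inr i) => y 0 i
  | inr t => 2^-1 * a_ t * (z 0 (val t).1.1 * y 0 (val t).1.2) end.
have uE k : \sum_(s | split_index s == k) u s = x 0 k.
  by rewrite big_split_index/= !big_pred1_eq xE.
have := multinomial_coloured split_index u a.
rewrite (reindex_fsbig _ _ _ _ (join_multi_bij a)) big_split/= => e.
have a_neq0 : (multi_fact a)%:R != 0 :> R.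
  rewrite pnatr_eq0 -lt0n /multi_fact prodn_gt0// => i; exact: fact_gt0.
have -> : monomial x a = (multi_fact a)%:R *
    (\prod_k (\sum_(s | split_index s == k) u s) ^+ a k * \prod_k ((a k)`!%:R)^-1).
  rewrite mulrCA prodfV -natr_prod mulfV// mulr1.
  by apply: eq_bigr => k _; rewrite uE.
rewrite e mulr_fsumr; apply: eq_fsbigr => -[[b c] s] /[!inE] pa.
rewrite /multi_binom -!mulrA; congr (_ * _).
have {pa}aE : a = b + c + sigma0 s by [].
have -> : [ffun k => (a k - b k - sigma0 s k)%N] = c.
  by apply/ffunP => k; rewrite ffunE aE !multiD -addnA addKn addnK.
rewrite !monomialD !monomial_fibre /c_sigma -!/(monomial _ _).
rewrite /divpow big_split_index/=.
under eq_bigr do rewrite ffunE.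
under [X in _ * X * _]eq_bigr do rewrite ffunE.
under [X in _ * _ * X]eq_bigr do rewrite ffunE /= 2!exprMn exprVn exprMn.
rewrite !big_split/= -!/(monomial _ _) !natrM !invfM.
rewrite /multi_fact !natr_prod -!prodfV.
have -> : \prod_(t : triples) (2 ^+ s t)^-1 = 2 ^- (\sum_t s t)%N :> R.
  by rewrite prodfV prodrXr.
ring.
Qed.

End Decomposition.

(** * Measurability of continuous functions of several variables *)

Section Row.
Context (R : realType).
Local Notation T := (measurableTypeR R).

Definition tuple_row n (t : n.-tuple T) : 'rV[R]_n := \row_i tnth t i.

(** The sigma-algebra on tuples is generated by the coordinates.  A continuous
    function is the limit of its values at the points of the grids of mesh
    1 / (k + 1), and these approximations are constant on each of countably
    many boxes. *)
Lemma continuous_measurable_tuple_row n (f : 'rV[R]_n -> R) :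
  continuous f -> measurable_fun setT (f \o @tuple_row n).
Proof.
move=> cf.
(* rounding down to the grid of mesh 1 / (k + 1) *)
pose rnd (k : nat) (x : R) : R := (Num.floor (x * k.+1%:R))%:~R / k.+1%:R.
apply: (@measurable_fun_cvg _ _ _ _
  (fun k t => f (map_mx (rnd k) (tuple_row t)))).
- move=> k _ Y _; rewrite setTI.
  pose cell (z : n.-tuple int) : set (n.-tuple T) :=
    [set t | forall i, Num.floor (tnth t i * k.+1%:R) = tnth z i].
  pose U (z : n.-tuple int) : set (n.-tuple T) :=
    if f (\row_i ((tnth z i)%:~R / k.+1%:R)) \in Y then cell z else set0.
  rewrite (_ : _ @^-1` _ = \bigcup_z U z); last first.
    apply/seteqP; split => t.
      move=> /= Yt; exists [tuple Num.floor (tnth t i * k.+1%:R) | i < n] => //.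
      rewrite /U (_ : (\row_i _) = map_mx (rnd k) (tuple_row t)).
        by rewrite mem_set// => i; rewrite tnth_mktuple.
      by apply/rowP => i; rewrite !mxE tnth_mktuple.
    move=> [z _]; rewrite /U; case: ifPn => //; rewrite inE => Yz tz /=.
    rewrite (_ : map_mx _ _ = \row_i ((tnth z i)%:~R / k.+1%:R))//.
    by apply/rowP => i; rewrite !mxE /rnd tz.
  apply: countable_bigcupT_measurable; first exact: countableP.
  move=> z; rewrite /U; case: ifPn => // _.
  rewrite (_ : cell z = \bigcap_(i in [set: 'I_n])
      (fun t : n.-tuple T => tnth t i) @^-1`
      `[(tnth z i)%:~R / k.+1%:R, (tnth z i + 1)%:~R / k.+1%:R[%classic).
    apply: fin_bigcap_measurable => // i _.
    rewrite -[X in measurable X]setTI.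
    by apply: measurable_tnth => //; exact: measurable_itv.
  have k0 : 0 < k.+1%:R :> R by [].
  apply/seteqP; split => t /= tz i.
    move=> _ /=; rewrite in_itv/= ler_pdivrMr// ltr_pdivlMr//.
    by rewrite -tz floor_itv.
  have /= := tz i I; rewrite in_itv/= ler_pdivrMr// ltr_pdivlMr//.
  by move/floor_def.
- move=> t _.
  apply: (@cvg_comp _ _ _ (fun k => map_mx (rnd k) (tuple_row t)) f _
    (nbhs (tuple_row t))); last exact: cf.
  apply/cvg_ballP => e e0; near=> k.
  split => // i j; rewrite !mxE /ball/=.
  have k0 : 0 < k.+1%:R :> R by [].
  set x := tnth t j.
  have /andP[h1 h2] := floor_itv (x * k.+1%:R).
  rewrite ger0_norm; last by rewrite subr_ge0 /rnd ler_pdivrMr.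
  apply: (@le_lt_trans _ _ k.+1%:R^-1); last first.
    by near: k; exact: (near_infty_natSinv_lt (PosNum e0)).
  rewrite /rnd lerBlDr -[X in X + _]mul1r -mulrDl ler_pdivlMr// addrC.
  by move/ltW: h2; rewrite intrD.
Unshelve. all: by end_near. Qed.

End Row.

(** * Integrals of derivatives *)

Section OneDim.
Context (R : realType).
Local Notation mu := (@lebesgue_measure R).

Lemma oneDsqr_gt0 (x : R) : 0 < oneDsqr x.
Proof. exact: lt_le_trans ltr01 (oneDsqr_ge1 x). Qed.

Lemma integrable_oneDsqrV :
  mu.-integrable setT (fun x : measurableTypeR R => ((oneDsqr x)^-1)%:E).
Proof.
have m1 : measurable_fun [set: measurableTypeR R]
    (fun x : measurableTypeR R => ((oneDsqr x)^-1 : R)).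
  by apply: continuous_measurable_fun; exact: continuous_oneDsqrV.
apply/integrableP; split; first exact/measurable_EFinP.
under eq_integral do rewrite /= ger0_norm ?invr_ge0 ?ltW ?oneDsqr_gt0//.
rewrite ge0_symfun_integralT.
- by rewrite -set_itvcy integral0y_oneDsqr -EFinM ltry.
- by move=> x; rewrite invr_ge0 ltW ?oneDsqr_gt0.
- exact: continuous_oneDsqrV.
- by move=> x; rewrite /= /oneDsqr sqrrN.
Qed.

(** The integral over [-n, n] is phi n - phi (-n), which tends to 0; the decay
    of psi lets n tend to infinity. *)
Lemma integral_derivative_eq0 (phi psi : R -> R) (M : R) :
  (forall x : R, is_derive x 1 phi (psi x)) -> continuous psi ->
  (forall x, `|phi x| <= M * (oneDsqr x)^-1) ->
  (forall x, `|psi x| <= M * (oneDsqr x)^-1) ->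
  (\int[mu]_x (psi x)%:E = 0)%E.
Proof.
move=> dphi cpsi phiM psiM.
have cphi : continuous phi.
  by move=> x; apply: differentiable_continuous; apply/derivable1_diffP; exact: ex_derive.
pose A (n : nat) : set (measurableTypeR R) := `[- n.+1%:R, n.+1%:R]%classic.
have mpsi : measurable_fun [set: measurableTypeR R] psi.
  exact: continuous_measurable_fun.
have intE n : (\int[mu]_x ((EFin \o psi) \_ (A n)) x)%E =
    (phi n.+1%:R - phi (- n.+1%:R))%:E.
  rewrite -integral_mkcond (@continuous_FTC2 _ _ phi)//.
  - by rewrite (@lt_trans _ _ 0)// oppr_lt0.
  - by apply: continuous_subspaceT.
  - split.
    + by move=> x _; exact: ex_derive.
    + by apply: cvg_at_right_filter; exact: cphi.
    + by apply: cvg_at_left_filter; exact: cphi.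
  - by move=> x _; rewrite derive1E; exact: derive_val.
have lim1 : (\int[mu]_x ((EFin \o psi) \_ (A n)) x)%E @[n --> \oo] -->
    (\int[mu]_x (psi x)%:E)%E.
  apply: (@dominated_cvg _ _ _ mu setT _ (fun n => (EFin \o psi) \_ (A n))
    (EFin \o psi) (fun x => (M * (oneDsqr x)^-1)%:E)) => //.
  - by move=> n; apply/(measurable_restrictT _ _).1; [exact: measurable_itv|
      exact/measurable_funTS/measurable_EFinP].
  - move=> x _; apply: cvg_near_cst; near=> n.
    rewrite patchE mem_set// /A/= in_itv/= -ler_norml.
    apply: (@le_trans _ _ n%:R); last by rewrite ler_nat.
    by near: n; exact: nbhs_infty_ger.
  - under eq_fun do rewrite EFinM.
    by apply: integrableZl => //; exact: integrable_oneDsqrV.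
  - move=> n x _; rewrite patchE; case: ifPn => _; first by rewrite lee_fin.
    by rewrite abse0 lee_fin (le_trans _ (psiM x)).
have lim2 : (\int[mu]_x ((EFin \o psi) \_ (A n)) x)%E @[n --> \oo] --> 0%E.
  under eq_cvg do rewrite intE.
  apply: cvg_EFin; first exact: nearW.
  have lim3 (s : R) : s = 1 \/ s = -1 -> phi (s * n.+1%:R) @[n --> \oo] --> (0 : R).
    move=> s1; apply: norm_cvg0.
    apply: (@squeeze_cvgr _ _ _ _ (cst 0) (fun n => M * n.+1%:R^-1)).
    - apply: nearW => n; rewrite normr_ge0/=.
      rewrite (le_trans (phiM _))// ler_wpM2l//.
        by have := phiM 0; rewrite /oneDsqr expr0n/= addr0 invr1 mulr1; apply: le_trans.
      rewrite lef_pV2 ?posrE ?oneDsqr_gt0// /oneDsqr.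
      have -> : (s * n.+1%:R) ^+ 2 = n.+1%:R ^+ 2 :> R.
        by rewrite exprMn; case: s1 => ->; rewrite ?sqrrN expr1n mul1r.
      by rewrite -[leLHS]add0r lerD// -[leLHS]mulr1 expr2 ler_pM2l// ler1n.
    - exact: cvg_cst.
    - by rewrite -(mulr0 M); apply: cvgMl_tmp; exact: cvg_harmonic.
  rewrite -(subr0 (0:R)); apply: cvgB.
  - by under eq_cvg do rewrite -[X in phi X]mul1r; apply: lim3; left.
  - by under eq_cvg do rewrite -mulN1r; apply: lim3; right.
exact: (cvg_unique _ lim1 lim2).
Unshelve. all: by end_near. Qed.

(** Directional derivatives are derivatives at 0 along a line; this reduces
    the several-variable derivatives below to real functions. *)
Lemma is_derive_line (V W : normedModType R) (f : V -> W) (a v : V) (df : W) :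
  is_derive (0 : R) 1 (fun h => f (a + h *: v)) df <-> is_derive a v f df.
Proof.
have e : (fun h : R => h^-1 *: (((fun k : R => f (a + k *: v)) \o shift 0) (h *: 1) -
    f (a + 0 *: v))) = (fun h : R => h^-1 *: ((f \o shift a) (h *: v) - f a)).
  apply/funext => h.
  by rewrite /= scale0r !addr0 -[h *: 1]/(h * 1) mulr1 [a + _]addrC.
split=> -[df1 df2]; split.
- by move: df1; rewrite /derivable e.
- by move: df2; rewrite /derive e.
- by rewrite /derivable e.
- by rewrite /derive e.
Qed.

End OneDim.

Section TupleIntegral.
Context (R : realType).
Local Notation T := (measurableTypeR R).
Local Notation leb := (@lebesgue_measure R).
Local Notation lebt := (@lebesgue_tuple R).

Lemma integrable_lebesgue_tupleS n (f : n.+1.-tuple T -> \bar R) :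
  measurable_fun setT f ->
  (leb \x lebt n)%E.-integrable setT (f \o @tcons R n) ->
  (lebt n.+1).-integrable setT f.
Proof.
move=> mf intf.
exact: (@integrable_pushforward _ _ _ _ _ _ (@measurable_tcons R n)).
Qed.

Lemma integral_lebesgue_tupleS n (f : n.+1.-tuple T -> \bar R) :
  measurable_fun setT f ->
  (leb \x lebt n)%E.-integrable setT (f \o @tcons R n) ->
  (\int[lebt n.+1]_t f t = \int[leb \x lebt n]_p f (tcons p))%E.
Proof.
move=> mf intf.
by have := @integral_pushforward _ _ _ _ _ _ (@measurable_tcons R n)
  (leb \x lebt n)%E setT f mf intf measurableT.
Qed.

Definition row_cons n (x : R) (v : 'rV[R]_n) : 'rV[R]_n.+1 :=
  \row_i oapp (v 0) x (unlift ord0 i).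

Lemma tuple_row_tcons n (p : T * n.-tuple T) :
  tuple_row (tcons p) = row_cons p.1 (tuple_row p.2).
Proof.
apply/rowP => i; rewrite !mxE; case: unliftP => [j ->|->] /=.
  by rewrite mxE tnthS.
by rewrite tnth0.
Qed.

Lemma row_cons_add0 n x (v : 'rV[R]_n) h :
  row_cons x v + h *: delta_mx 0 0 = row_cons (x + h) v.
Proof.
apply/rowP => i; rewrite !mxE eqxx /=; case: unliftP => [j ->|->] /=.
  by rewrite mulr0 addr0.
by rewrite ?eqxx mulr1.
Qed.

Lemma row_cons_addS n x (v : 'rV[R]_n) (j : 'I_n) h :
  row_cons x v + h *: delta_mx 0 (lift ord0 j) =
  row_cons x (v + h *: delta_mx 0 j).
Proof.
apply/rowP => i; rewrite !mxE eqxx /=; case: unliftP => [k ->|->] /=.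
  by rewrite !mxE eqxx/= (inj_eq lift_inj).
by rewrite mulr0 addr0.
Qed.

Definition weight n (v : 'rV[R]_n) : R := \prod_i (oneDsqr (v 0 i))^-1.

Lemma weight_gt0 n (v : 'rV[R]_n) : 0 < weight v.
Proof. by apply: prodr_gt0 => i _; rewrite invr_gt0 oneDsqr_gt0. Qed.

Lemma weight_row_cons n x (v : 'rV[R]_n) :
  weight (row_cons x v) = (oneDsqr x)^-1 * weight v.
Proof.
rewrite /weight big_ord_recl mxE unlift_none/=; congr (_ * _).
by apply: eq_bigr => i _; rewrite mxE liftK.
Qed.

Lemma measurable_coord n (i : 'I_n) :
  measurable_fun setT (fun t : n.-tuple T => tuple_row t 0 i : R).
Proof. by under eq_fun do rewrite mxE; exact: measurable_tnth. Qed.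

Lemma measurable_oneDsqrV : measurable_fun setT (fun x : T => (oneDsqr x)^-1 : R).
Proof. by apply: continuous_measurable_fun; exact: continuous_oneDsqrV. Qed.

Lemma measurable_weight n : measurable_fun setT (@weight n \o @tuple_row R n).
Proof.
apply: measurable_prod => i _.
apply: (measurableT_comp measurable_oneDsqrV); exact: measurable_coord.
Qed.

Lemma measurable_weight_tcons n :
  measurable_fun setT (@weight n.+1 \o @tuple_row R n.+1 \o @tcons R n).
Proof.
apply: measurableT_comp; first exact: measurable_weight.
exact: measurable_tcons.
Qed.

Lemma integrable_weight_tcons n :
  (lebt n).-integrable setT (EFin \o (@weight n \o @tuple_row R n)) ->
  (leb \x lebt n)%E.-integrable setT
    (EFin \o (@weight n.+1 \o @tuple_row R n.+1 \o @tcons R n)).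
Proof.
move=> /integrableP[_ woo]; have /integrableP[_ oo1] := @integrable_oneDsqrV R.
apply/integrable12ltyP.
  by apply/measurable_EFinP; exact: measurable_weight_tcons.
pose C := (\int[lebt n]_y `|weight (tuple_row y)|%:E)%E.
rewrite (eq_integral (fun x : T => `|(oneDsqr x)^-1|%:E * C)%E); last first.
  move=> x _; rewrite -ge0_integralZl//.
    apply: eq_integral => y _.
    by rewrite /= tuple_row_tcons weight_row_cons normrM EFinM.
  by apply/measurable_EFinP/measurableT_comp => //; exact: measurable_weight.
rewrite ge0_integralZr//.
- by rewrite lte_mul_pinfty// ?integral_ge0// ge0_fin_numE// integral_ge0.
- by apply/measurable_EFinP/measurableT_comp => //; exact: measurable_oneDsqrV.
- by apply: integral_ge0.
Qed.

Lemma integrable_weight n :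
  (lebt n).-integrable setT (EFin \o (@weight n \o @tuple_row R n)).
Proof.
elim: n => [|n IH]; last first.
  apply: integrable_lebesgue_tupleS; last exact: integrable_weight_tcons.
  by apply/measurable_EFinP; exact: measurable_weight.
have mw := @measurable_weight 0.
apply/integrableP; split; first exact/measurable_EFinP.
rewrite integral_dirac//; first by rewrite diracT mul1e ltry.
by apply: measurableT_comp => //; exact/measurable_EFinP.
Qed.

Lemma integrable_le_weight n (f : 'rV[R]_n -> R) (M : R) :
  measurable_fun setT (f \o @tuple_row R n) ->
  (forall v, `|f v| <= M * weight v) ->
  (lebt n).-integrable setT (EFin \o (f \o @tuple_row R n)).
Proof.
move=> mf fM.
apply: (@le_integrable _ _ _ _ _ _ _
   (fun t => M%:E * (EFin \o (@weight n \o @tuple_row R n)) t)%E) => //.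
- exact/measurable_EFinP.
- move=> t _; rewrite /= lee_fin (le_trans (fM _))// normrM ler_pM//.
  + by rewrite -(pmulr_lge0 _ (weight_gt0 (tuple_row t))) (le_trans _ (fM (tuple_row t))).
  + exact/ltW/weight_gt0.
  + exact: ler_norm.
  + exact: ler_norm.
- by apply: integrableZl => //; exact: integrable_weight.
Qed.

(** Integrate first over the variable of the derivative, where the
    one-dimensional case applies.  In the recursive description of the
    measure this is the head variable, or a variable of the tail, for which
    the induction hypothesis is applied to the slices. *)
Lemma integral_partial_eq0 n (j : 'I_n) (phi psi : 'rV[R]_n -> R) (M : R) :
  (forall v, is_derive (0 : R) 1 (fun h : R => phi (v + h *: delta_mx 0 j)) (psi v)) ->
  (forall v, continuous (fun h : R => psi (v + h *: delta_mx 0 j))) ->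
  measurable_fun setT (psi \o @tuple_row R n) ->
  (forall v, `|phi v| <= M * weight v) ->
  (forall v, `|psi v| <= M * weight v) ->
  (\int[lebt n]_t (psi (tuple_row t))%:E = 0)%E.
Proof.
elim: n => [|n IH] in j phi psi M *; first by case: j.
move=> dphi cpsi mpsi phiM psiM.
have mcons : measurable_fun setT (EFin \o (psi \o @tuple_row R n.+1) \o @tcons R n).
  apply: measurableT_comp; last exact: measurable_tcons.
  exact/measurable_EFinP.
have intpsi : (leb \x lebt n)%E.-integrable setT
    (EFin \o (psi \o @tuple_row R n.+1) \o @tcons R n).
  apply: (@le_integrable _ _ _ _ _ _ _
    (fun p => M%:E * (EFin \o (@weight n.+1 \o @tuple_row R n.+1 \o @tcons R n)) p)%E) => //.
    by move=> p _; rewrite /= lee_fin (le_trans (psiM _))// ler_norm.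
  by apply: integrableZl => //; exact/integrable_weight_tcons/integrable_weight.
rewrite (integral_lebesgue_tupleS (f := EFin \o (psi \o @tuple_row R n.+1)))//;
  last exact/measurable_EFinP.
have M0 : 0 <= M.
  by have := le_trans (normr_ge0 _) (phiM 0); rewrite pmulr_lge0 ?weight_gt0.
case: (unliftP ord0 j) => [k|] jE.
  rewrite -(@integral12_prod_meas1 _ _ _ _ _ leb (lebt n) _ intpsi).
  rewrite /fubini_F integral0_eq// => x _ /=.
  under eq_integral do rewrite tuple_row_tcons/=.
  have phix (q : 'rV[R]_n.+1 -> R) v (h : R) :
    q (row_cons x v + h *: delta_mx 0 j) = (q \o row_cons x) (v + h *: delta_mx 0 k).
    by rewrite /= jE row_cons_addS.
  apply: (IH k (phi \o row_cons x) (psi \o row_cons x) (M * (oneDsqr x)^-1)).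
  - move=> v; have := dphi (row_cons x v).
    by under eq_fun do rewrite phix.
  - move=> v; have := cpsi (row_cons x v).
    by under eq_fun do rewrite phix.
  - rewrite (_ : _ \o _ = (psi \o @tuple_row R n.+1 \o @tcons R n) \o pair x).
      apply: (measurableT_comp _ (pair1_measurable x)).
      exact/measurable_EFinP.
    by apply/funext => t /=; rewrite tuple_row_tcons.
  - by move=> v; rewrite (le_trans (phiM _))// weight_row_cons mulrA.
  - by move=> v; rewrite (le_trans (psiM _))// weight_row_cons mulrA.
rewrite -(@integral21_prod_meas1 _ _ _ _ _ leb (lebt n) _ intpsi).
rewrite /fubini_G integral0_eq// => t _ /=.
under eq_integral do rewrite tuple_row_tcons/=.
have phix (q : 'rV[R]_n.+1 -> R) x (h : R) :
  q (row_cons x (tuple_row t) + h *: delta_mx 0 j) = q (row_cons (x + h) (tuple_row t)).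
  by rewrite jE row_cons_add0.
apply: (@integral_derivative_eq0 _ (fun x => phi (row_cons x (tuple_row t))) _
  (M * weight (tuple_row t))).
- move=> x; have := dphi (row_cons x (tuple_row t)).
  under eq_fun do rewrite phix.
  move=> dx; apply/is_derive_line; move: dx.
  by under [in X in _ -> X]eq_fun do rewrite -[_ *: 1]/(_ * 1) mulr1.
- have := cpsi (row_cons 0 (tuple_row t)).
  under eq_fun do rewrite phix.
  by under eq_fun do rewrite add0r.
- move=> x; rewrite (le_trans (phiM _))// weight_row_cons.
  by rewrite mulrCA mulrC -mulrA.
- move=> x; rewrite (le_trans (psiM _))// weight_row_cons.
  by rewrite mulrCA mulrC -mulrA.
Qed.

End TupleIntegral.

(** * Rapidly decreasing functions *)

Section Rapid.
Context (R : realType) (n : nat).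
Local Notation T := (measurableTypeR R).
Local Notation lebt := (@lebesgue_tuple R n).
Implicit Types (u : 'rV[R]_n -> R) (v w : 'rV[R]_n).

Definition decays u := forall a : {ffun 'I_n -> nat},
  exists M : R, forall v, `|monomial v a * u v| <= M.

Lemma decaysD u1 u2 : decays u1 -> decays u2 -> decays (fun v => u1 v + u2 v).
Proof.
move=> d1 d2 a; have [M1 h1] := d1 a; have [M2 h2] := d2 a.
by exists (M1 + M2) => v; rewrite mulrDr (le_trans (ler_normD _ _))// lerD.
Qed.

Lemma decaysM u b (M : R) : (forall v, `|b v| <= M) -> decays u ->
  decays (fun v => b v * u v).
Proof.
move=> bM du a; have [N h] := du a; exists (M * N) => v.
by rewrite mulrCA normrM ler_pM.
Qed.

Lemma monomial_unit v i : monomial v (unit_multi i) = v 0 i.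
Proof.
rewrite /monomial (bigD1 i)//= ffunE eqxx expr1 big1 ?mulr1// => j /negPf ji.
by rewrite ffunE ji expr0.
Qed.

Lemma decays_monomialM u a : decays u -> decays (fun v => monomial v a * u v).
Proof.
move=> du b; have [M h] := du (b + a); exists M => v.
by rewrite mulrA -monomialD.
Qed.

(** The product of all 1 + v_i^2 with u decays again, since (1 + v_i^2) u is
    the sum of u and a monomial times u; in particular it is bounded. *)
Lemma decays_weight u : decays u -> exists M, forall v, `|u v| <= M * weight v.
Proof.
move=> du; suff : decays (fun v => \prod_i (oneDsqr (v 0 i)) * u v).
  move=> /(_ 0)[M h]; exists M => v.
  rewrite /weight prodfV ler_pdivlMr; last by apply: prodr_gt0 => i _; exact: oneDsqr_gt0.
  have := h v; rewrite /monomial big1 ?mul1r; last by move=> i _; rewrite ffunE expr0.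
  rewrite normrM mulrC [X in _ * X]ger0_norm//.
  by apply: prodr_ge0 => i _; exact/ltW/oneDsqr_gt0.
elim: (index_enum _) => [|i s IH].
  by move=> a; have [M h] := du a; exists M => v; rewrite big_nil mul1r.
rewrite (_ : (fun _ => _) = (fun v =>
    \prod_(j <- s) oneDsqr (v 0 j) * u v +
    monomial v (unit_multi i + unit_multi i) * (\prod_(j <- s) oneDsqr (v 0 j) * u v))).
  by apply: decaysD => //; exact: decays_monomialM.
apply/funext => v.
by rewrite big_cons monomialD monomial_unit {1}/oneDsqr -expr2 -mulrA mulrDl mul1r.
Qed.

Definition rapid u := measurable_fun setT (u \o @tuple_row R n) /\ decays u.

Lemma rapid_integrable u : rapid u ->
  lebt.-integrable setT (EFin \o (u \o @tuple_row R n)).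
Proof.
by move=> [mu /decays_weight[M h]]; exact: integrable_le_weight h.
Qed.

Lemma rapidD u1 u2 : rapid u1 -> rapid u2 -> rapid (fun v => u1 v + u2 v).
Proof.
move=> [m1 d1] [m2 d2]; split; last exact: decaysD.
exact: measurable_funD.
Qed.

Lemma rapidM u (b : 'rV[R]_n -> R) (M : R) :
  measurable_fun setT (b \o @tuple_row R n) ->
  (forall v, `|b v| <= M) -> rapid u -> rapid (fun v => b v * u v).
Proof.
move=> mb bM [m1 d1]; split; last exact: decaysM bM d1.
exact: measurable_funM.
Qed.

Lemma rapidZ u (c : R) : rapid u -> rapid (fun v => c * u v).
Proof. by move=> ru; apply: (@rapidM _ (cst c) `|c|) => //; exact: measurable_cst. Qed.

Lemma rapidN u : rapid u -> rapid (fun v => - u v).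
Proof. by move=> /(rapidZ (-1)); under eq_fun do rewrite mulN1r. Qed.

Lemma measurable_monomial a :
  measurable_fun setT ((fun v => monomial v a) \o @tuple_row R n).
Proof.
by apply: measurable_prod => i _; apply: measurable_funX; exact: measurable_coord.
Qed.

Lemma rapid_monomialM u a : rapid u -> rapid (fun v => monomial v a * u v).
Proof.
move=> [m1 d1]; split; last exact: decays_monomialM.
by apply: measurable_funM => //; exact: measurable_monomial.
Qed.

Implicit Types (F G : 'rV[R]_n -> R[i]).
Local Notation Re := complex.Re.
Local Notation Im := complex.Im.

Lemma Re_mul (a b : R[i]) : Re (a * b) = Re a * Re b - Im a * Im b.
Proof. by case: a b => [? ?] [? ?]. Qed.

Lemma Im_mul (a b : R[i]) : Im (a * b) = Re a * Im b + Im a * Re b.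
Proof. by case: a b => [? ?] [? ?]. Qed.

Lemma Re_add (a b : R[i]) : Re (a + b) = Re a + Re b.
Proof. by case: a b => [? ?] [? ?]. Qed.

Lemma Im_add (a b : R[i]) : Im (a + b) = Im a + Im b.
Proof. by case: a b => [? ?] [? ?]. Qed.

Lemma complex_eq (a b : R[i]) : Re a = Re b -> Im a = Im b -> a = b.
Proof. by case: a b => [? ?] [? ?] /= -> ->. Qed.

Definition crapid F := rapid (fun v => Re (F v)) /\ rapid (fun v => Im (F v)).

Lemma crapidM F (B : 'rV[R]_n -> R[i]) (M : R) :
  measurable_fun setT (fun t => Re (B (@tuple_row R n t))) ->
  measurable_fun setT (fun t => Im (B (@tuple_row R n t))) ->
  (forall v, `|Re (B v)| <= M) -> (forall v, `|Im (B v)| <= M) ->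
  crapid F -> crapid (fun v => B v * F v).
Proof.
move=> mr mi rM iM [rF iF]; split.
  under eq_fun do rewrite Re_mul -mulNr.
  apply: rapidD; first exact: rapidM mr rM rF.
  apply: (@rapidM _ (fun v => - Im (B v)) M) => //.
    by apply: measurableT_comp.
  by move=> v; rewrite normrN.
under eq_fun do rewrite Im_mul.
by apply: rapidD; [exact: rapidM mr rM iF|exact: rapidM mi iM rF].
Qed.

Lemma crapidD F G : crapid F -> crapid G -> crapid (fun v => F v + G v).
Proof.
move=> [rF iF] [rG iG]; split.
  by under eq_fun do rewrite Re_add; exact: rapidD.
by under eq_fun do rewrite Im_add; exact: rapidD.
Qed.

Lemma crapidZ F (c : R[i]) : crapid F -> crapid (fun v => c * F v).
Proof.
move=> cF; apply: (@crapidM _ (cst c) (`|Re c| + `|Im c|)) => //.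
- by move=> v; rewrite lerDl.
- by move=> v; rewrite lerDr.
Qed.

Lemma crapid_monomialM F a : crapid F -> crapid (fun v => (monomial v a)%:C * F v).
Proof.
move=> [rF iF]; split.
  by under eq_fun do rewrite Re_mul /= mul0r subr0; exact: rapid_monomialM.
by under eq_fun do rewrite Im_mul /= mul0r addr0; exact: rapid_monomialM.
Qed.

Definition cintegrable F :=
  lebt.-integrable setT (EFin \o ((fun v => Re (F v)) \o @tuple_row R n)) /\
  lebt.-integrable setT (EFin \o ((fun v => Im (F v)) \o @tuple_row R n)).

Lemma crapid_integrable F : crapid F -> cintegrable F.
Proof. by move=> [rF iF]; split; exact: rapid_integrable. Qed.

Lemma cintegralE F : cintegral F =
  Rintegral lebt setT ((fun v => Re (F v)) \o @tuple_row R n) +i*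
  Rintegral lebt setT ((fun v => Im (F v)) \o @tuple_row R n).
Proof. by []. Qed.

Lemma cintegralD F G : cintegrable F -> cintegrable G ->
  cintegral (fun v => F v + G v) = cintegral F + cintegral G.
Proof.
move=> [rF iF] [rG iG]; rewrite !cintegralE; apply: complex_eq; rewrite ?Re_add ?Im_add/=.
- rewrite -RintegralD//; congr Rintegral; apply/funext => t /=; exact: Re_add.
- rewrite -RintegralD//; congr Rintegral; apply/funext => t /=; exact: Im_add.
Qed.

Lemma cintegralZ F (c : R[i]) : cintegrable F ->
  cintegral (fun v => c * F v) = c * cintegral F.
Proof.
move=> [rF iF]; rewrite !cintegralE; apply: complex_eq; rewrite ?Re_mul ?Im_mul/=.
- rewrite -!RintegralZl// -RintegralB//.
  + by congr Rintegral; apply/funext => t /=; exact: Re_mul.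
  + exact: (integrableZl measurableT _ rF).
  + exact: (integrableZl measurableT _ iF).
- rewrite -!RintegralZl// -RintegralD//.
  + by congr Rintegral; apply/funext => t /=; exact: Im_mul.
  + exact: (integrableZl measurableT _ iF).
  + exact: (integrableZl measurableT _ rF).
Qed.

Lemma cintegral_sum (I : Type) (s : seq I) (c : I -> R[i]) (F : I -> 'rV[R]_n -> R[i]) :
  (forall i, crapid (F i)) ->
  crapid (fun v => \sum_(i <- s) c i * F i v) /\
  cintegral (fun v => \sum_(i <- s) c i * F i v) = \sum_(i <- s) c i * cintegral (F i).
Proof.
move=> rF; elim: s => [|i s [IH1 IH2]].
  under eq_fun do rewrite big_nil.
  rewrite big_nil; split.
    have r0 : rapid (cst 0).
      split; first exact: measurable_cst.
      by move=> a; exists 0 => v; rewrite mulr0 normr0.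
    by split.
  by rewrite cintegralE; apply: complex_eq => /=; rewrite Rintegral_cst// mul0r.
under eq_fun do rewrite big_cons.
have rc : crapid (fun v => c i * F i v) by exact: crapidZ.
split; first exact: crapidD.
rewrite big_cons cintegralD; [|exact: crapid_integrable..].
by rewrite cintegralZ ?IH2//; exact: crapid_integrable.
Qed.

Lemma le_cintegral F (K : 'rV[R]_n -> R) :
  cintegrable F -> lebt.-integrable setT (EFin \o (K \o @tuple_row R n)) ->
  (forall v, `|Re (F v)| <= K v) -> (forall v, `|Im (F v)| <= K v) ->
  `|Re (cintegral F)| <= Rintegral lebt setT (K \o @tuple_row R n) /\
  `|Im (cintegral F)| <= Rintegral lebt setT (K \o @tuple_row R n).
Proof.
move=> [rF iF] iK rK iKK; rewrite cintegralE /=; split.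
- rewrite (le_trans (le_normr_Rintegral _ _))// le_Rintegral//.
  exact: (integrable_norm rF).
- rewrite (le_trans (le_normr_Rintegral _ _))// le_Rintegral//.
  exact: (integrable_norm iF).
Qed.

End Rapid.

(** * Oscillatory integrals *)

Section ParamIntegral.
Context d1 d2 (T1 : measurableType d1) (T2 : measurableType d2) (R : realType).
Context (mu : {sigma_finite_measure set T2 -> \bar R}).

(** Fubini's theorem gives this for nonnegative functions, and the integral is
    the difference of those of the positive and negative parts. *)
Lemma measurable_Rintegral_param (k : T1 * T2 -> R) :
  measurable_fun setT k ->
  measurable_fun setT (fun x => Rintegral mu setT (fun y => k (x, y))).
Proof.
move=> /measurable_EFinP mk; apply: measurableT_comp => //.
rewrite (_ : (fun x => _) = (fun x =>
  (\int[mu]_y (EFin \o k)^\+ (x, y) - \int[mu]_y (EFin \o k)^\- (x, y))%E)).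
  apply: emeasurable_funB.
    apply: (@measurable_fun_fubini_tonelli_F _ _ _ _ _ mu) => //.
    exact: measurable_funepos.
  apply: (@measurable_fun_fubini_tonelli_F _ _ _ _ _ mu) => //.
  exact: measurable_funeneg.
apply/funext => x.
by rewrite [LHS](integralE mu setT ((EFin \o k) \o pair x)) funepos_comp funeneg_comp.
Qed.

End ParamIntegral.

Section Transform.
Context (R : realType) (n : nat).
Local Notation T := (measurableTypeR R).
Local Notation lebt := (@lebesgue_tuple R n).
Local Notation Re := complex.Re.
Local Notation Im := complex.Im.
Local Notation row := (@tuple_row R n).
Implicit Types (v w : 'rV[R]_n) (F G : 'rV[R]_n -> R[i]) (s : R).

Definition dot v w : R := \sum_i v 0 i * w 0 i.

(** The case s = 1 is the inverse Fourier transform and s = -1 the Fourier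
    transform, in coordinates and without the normalizing constants. *)
Definition ftransform s F w : R[i] := cintegral (fun v => cexpi (s * dot v w) * F v).

Lemma measurable_dot d1 (T1 : measurableType d1) (p q : T1 -> n.-tuple T) :
  measurable_fun setT p -> measurable_fun setT q ->
  measurable_fun setT (fun x => dot (row (p x)) (row (q x))).
Proof.
move=> mp mq; apply: measurable_sum => i; apply: measurable_funM.
- exact: (measurableT_comp (@measurable_coord R n i) mp).
- exact: (measurableT_comp (@measurable_coord R n i) mq).
Qed.

Lemma measurable_cos : measurable_fun setT (@cos R : T -> R).
Proof. by apply: continuous_measurable_fun; exact: continuous_cos. Qed.

Lemma measurable_sin : measurable_fun setT (@sin R : T -> R).
Proof. by apply: continuous_measurable_fun; exact: continuous_sin. Qed.

Lemma norm_cos_le1 (x : R) : `|cos x| <= 1.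
Proof. by rewrite ler_norml cos_geN1 cos_le1. Qed.

Lemma norm_sin_le1 (x : R) : `|sin x| <= 1.
Proof. by rewrite ler_norml sin_geN1 sin_le1. Qed.

Lemma crapid_cexpi s w F : crapid F -> crapid (fun v => cexpi (s * dot v w) * F v).
Proof.
have md : measurable_fun setT (fun t => s * dot (row t) w).
  apply: measurable_funM => //; apply: measurable_sum => i.
  by apply: measurable_funM => //; exact: measurable_coord.
apply: (@crapidM _ _ _ _ 1) => [||v|v] /=.
- exact: (measurableT_comp measurable_cos md).
- exact: (measurableT_comp measurable_sin md).
- exact: norm_cos_le1.
- exact: norm_sin_le1.
Qed.

Lemma norm_cexpiM (x : R) (z : R[i]) :
  `|Re (cexpi x * z)| <= `|Re z| + `|Im z| /\
  `|Im (cexpi x * z)| <= `|Re z| + `|Im z|.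
Proof.
rewrite Re_mul Im_mul /=; split.
  rewrite (le_trans (ler_normB _ _))// lerD// normrM ler_piMl//.
  - exact: norm_cos_le1.
  - exact: norm_sin_le1.
rewrite addrC (le_trans (ler_normD _ _))// lerD// normrM ler_piMl//.
- exact: norm_sin_le1.
- exact: norm_cos_le1.
Qed.

Lemma integrable_ReIm F : crapid F ->
  lebt.-integrable setT (EFin \o ((fun v => `|Re (F v)| + `|Im (F v)|) \o row)).
Proof.
move=> /crapid_integrable[rF iF].
exact: (integrableD measurableT (integrable_norm rF) (integrable_norm iF)).
Qed.

Lemma ftransform_bounded s F : crapid F -> exists M, forall w,
  `|Re (ftransform s F w)| <= M /\ `|Im (ftransform s F w)| <= M.
Proof.
move=> cF; eexists => w; apply: le_cintegral.
- exact/crapid_integrable/crapid_cexpi.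
- exact: integrable_ReIm cF.
- by move=> v; have [] := norm_cexpiM (s * dot v w) (F v).
- by move=> v; have [] := norm_cexpiM (s * dot v w) (F v).
Qed.

Lemma ftransformZ s F (c : R[i]) w : crapid F ->
  ftransform s (fun v => c * F v) w = c * ftransform s F w.
Proof.
move=> cF; rewrite /ftransform -cintegralZ; last exact/crapid_integrable/crapid_cexpi.
by congr cintegral; apply/funext => v; rewrite mulrCA.
Qed.

Lemma measurable_cintegral_param d1 (T1 : measurableType d1) (k : T1 -> 'rV[R]_n -> R[i]) :
  measurable_fun setT (fun p : T1 * n.-tuple T => Re (k p.1 (row p.2))) ->
  measurable_fun setT (fun p : T1 * n.-tuple T => Im (k p.1 (row p.2))) ->
  measurable_fun setT (fun x => Re (cintegral (k x))) /\
  measurable_fun setT (fun x => Im (cintegral (k x))).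
Proof.
move=> mr mi; split.
- exact: (measurable_Rintegral_param lebt mr).
- exact: (measurable_Rintegral_param lebt mi).
Qed.

Lemma ftransform_measurable s F : crapid F ->
  measurable_fun setT (fun t => Re (ftransform s F (row t))) /\
  measurable_fun setT (fun t => Im (ftransform s F (row t))).
Proof.
move=> [[mr _] [mi _]].
have mr2 : measurable_fun setT (fun p : n.-tuple T * n.-tuple T => Re (F (row p.2))).
  exact: (measurableT_comp mr).
have mi2 : measurable_fun setT (fun p : n.-tuple T * n.-tuple T => Im (F (row p.2))).
  exact: (measurableT_comp mi).
have md : measurable_fun setT
    (fun p : n.-tuple T * n.-tuple T => s * dot (row p.2) (row p.1)).
  by apply: measurable_funM => //; exact: measurable_dot.
have mc := measurableT_comp measurable_cos md.
have ms := measurableT_comp measurable_sin md.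
apply: measurable_cintegral_param.
- under eq_fun do rewrite Re_mul.
  by apply: measurable_funB; exact: measurable_funM.
- under eq_fun do rewrite Im_mul.
  by apply: measurable_funD; exact: measurable_funM.
Qed.

End Transform.

Section TransformDerivative.
Context (R : realType) (n : nat).
Local Notation T := (measurableTypeR R).
Local Notation lebt := (@lebesgue_tuple R n).
Local Notation Re := complex.Re.
Local Notation Im := complex.Im.
Local Notation row := (@tuple_row R n).
Implicit Types (v w : 'rV[R]_n) (F G : 'rV[R]_n -> R[i]) (s : R).

Lemma dotD v w1 w2 : dot v (w1 + w2) = dot v w1 + dot v w2.
Proof. by rewrite /dot -big_split; apply: eq_bigr => i _; rewrite mxE mulrDr. Qed.

Lemma dotC v w : dot v w = dot w v.
Proof. by apply: eq_bigr => i _; rewrite mulrC. Qed.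

Lemma dot_delta v (h : R) j : dot v (h *: delta_mx 0 j) = h * v 0 j.
Proof.
rewrite /dot (bigD1 j)//= !mxE !eqxx mulr1 mulrC big1 ?addr0// => i /negPf ij.
by rewrite !mxE eqxx ij !mulr0.
Qed.

Lemma is_derive_trig (a b x y h : R) :
  is_derive h 1 (fun h : R => a * cos (x + h * y) + b * sin (x + h * y))
    (y * (b * cos (x + h * y) - a * sin (x + h * y))).
Proof.
have lin : is_derive h (1 : R) (fun h : R => x + h * y) y.
  apply: is_derive_eq.
  by rewrite scaler0 !add0r mul1r [LHS]mulr1.
have dc : is_derive h (1 : R) (fun h : R => cos (x + h * y)) (- sin (x + h * y) * y).
  exact: (@is_derive1_comp _ _ (fun h : R => x + h * y) h _ _ (is_derive_cos _) lin).
have ds : is_derive h (1 : R) (fun h : R => sin (x + h * y)) (cos (x + h * y) * y).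
  exact: (@is_derive1_comp _ _ (fun h : R => x + h * y) h _ _ (is_derive_sin _) lin).
apply: is_derive_eq.
rewrite -![_ *: _]/(_ * _); ring.
Qed.

(** Real and imaginary parts of an oscillatory integral both have this form.
    Differentiating the integrand brings down a factor s v_j, and
    |s v_j| (|a v| + |b v|) is an integrable bound that does not depend on the
    point. *)
Lemma is_derive_trig_integral (a b : 'rV[R]_n -> R) s w j :
  rapid a -> rapid b ->
  is_derive w (delta_mx 0 j)
    (fun w => Rintegral lebt setT (fun t =>
       a (row t) * cos (s * dot (row t) w) + b (row t) * sin (s * dot (row t) w)))
    (Rintegral lebt setT (fun t =>
       s * row t 0 j * (b (row t) * cos (s * dot (row t) w) -
                        a (row t) * sin (s * dot (row t) w)))).
Proof.
move=> ra rb; apply/is_derive_line.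
pose x t := s * dot (row t) w.
pose y t := s * row t 0 j.
pose f (h : R) (t : n.-tuple T) : R :=
  a (row t) * cos (x t + h * y t) + b (row t) * sin (x t + h * y t).
have fE h t : a (row t) * cos (s * dot (row t) (w + h *: delta_mx 0 j)) +
    b (row t) * sin (s * dot (row t) (w + h *: delta_mx 0 j)) = f h t.
  by rewrite /f /x /y dotD dot_delta mulrDr mulrCA.
under eq_fun do under eq_Rintegral do rewrite fE.
have mx : measurable_fun setT x.
  apply: measurable_funM => //; apply: measurable_sum => i.
  by apply: measurable_funM => //; exact: measurable_coord.
have my : measurable_fun setT y.
  by apply: measurable_funM => //; exact: measurable_coord.
have dfE h t : partial1of2 f h t = y t * (b (row t) * cos (x t + h * y t) -
    a (row t) * sin (x t + h * y t)).
  rewrite partial1of2E; apply: derive_val; exact: is_derive_trig.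
pose G t := `|s| * (`|row t 0 j * a (row t)| + `|row t 0 j * b (row t)|).
have rint (c : 'rV[R]_n -> R) : rapid c ->
    lebt.-integrable setT (fun t => (`|row t 0 j * c (row t)|)%:E).
  move=> /(rapid_monomialM (unit_multi j))/rapid_integrable/integrable_norm.
  by under eq_fun do rewrite /= monomial_unit.
have intG : lebt.-integrable setT (EFin \o G).
  apply: (integrableZl measurableT `|s| (integrableD measurableT (rint _ ra) (rint _ rb))).
have intf (h : R) : lebt.-integrable setT (EFin \o f h).
  have [ma _] := ra; have [mb _] := rb.
  have mxy : measurable_fun setT (fun t => x t + h * y t).
    by apply: measurable_funD => //; exact: measurable_funM.
  have mc := measurableT_comp (@measurable_cos R) mxy.
  have ms := measurableT_comp (@measurable_sin R) mxy.
  apply: (@le_integrable _ _ _ _ _ _ _ (fun t => (`|a (row t)|%:E + `|b (row t)|%:E)%E)) => //.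
  - apply/measurable_EFinP; apply: measurable_funD; exact: measurable_funM.
  - move=> t _; rewrite /= lee_fin [leRHS]ger0_norm; last exact: addr_ge0.
    rewrite (le_trans (ler_normD _ _))// lerD// normrM ler_piMr//.
    + exact: norm_cos_le1.
    + exact: norm_sin_le1.
  - apply: integrableD => //; [exact: (integrable_norm (rapid_integrable ra))|].
    exact: (integrable_norm (rapid_integrable rb)).
have I0 : `]-1, 1[%classic (0 : R) by rewrite /= in_itv/= ltrN10 ltr01.
have G0 t : 0 <= G t by rewrite mulr_ge0// addr_ge0.
have fub (h : R) t : `|partial1of2 f h t| <= G t.
  rewrite dfE /G normrM (le_trans (ler_wpM2l _ (ler_normB _ _)))//.
  rewrite /y normrM -mulrA ler_wpM2l// mulrDr addrC !normrM lerD// ler_wpM2l// ler_piMr//.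
  + exact: norm_sin_le1.
  + exact: norm_cos_le1.
have der (h : R) t : derivable (f ^~ t) h 1.
  by case: (is_derive_trig (a (row t)) (b (row t)) (x t) (y t) h).
have diff := @differentiation_under_integral _ _ _ lebt f setT measurableT
  0 (-1) 1 I0 (fun h _ => intf h) (fun h t _ _ => der h t) G G0 intG
  (fun h t _ _ => fub h t).
split.
  exact: (@derivable_under_integral _ _ _ lebt f setT measurableT
    0 (-1) 1 I0 (fun h _ => intf h) (fun h t _ _ => der h t) G G0 intG
    (fun h t _ _ => fub h t)).
rewrite -derive1E diff; apply: eq_Rintegral => t _.
by rewrite dfE mul0r addr0.
Qed.

Lemma eq_is_derive (V : normedModType R) (f g : V -> R) (df dg : R) (x v : V) :
  f =1 g -> df = dg -> is_derive x v f df -> is_derive x v g dg.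
Proof. by move=> /funext -> ->. Qed.

(** Differentiating the exponential multiplies F by i s v_j. *)
Lemma is_derive_ftransform F s w j : crapid F ->
  let G v := 'i * (s * v 0 j)%:C * F v in
  is_derive w (delta_mx 0 j) (fun w => Re (ftransform s F w)) (Re (ftransform s G w)) /\
  is_derive w (delta_mx 0 j) (fun w => Im (ftransform s F w)) (Im (ftransform s G w)).
Proof.
move=> [rF iF] G; rewrite /ftransform /cintegral/=; split.
- apply: eq_is_derive (is_derive_trig_integral s w j rF (rapidN iF)).
    by move=> w0; apply: eq_Rintegral => t _; rewrite Re_mul/= -/(row t); ring.
  apply: eq_Rintegral => t _.
  by rewrite /G !(Re_mul, Im_mul)/= -/(row t); ring.
- apply: eq_is_derive (is_derive_trig_integral s w j iF rF).
    by move=> w0; apply: eq_Rintegral => t _; rewrite Im_mul/= -/(row t); ring.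
  apply: eq_Rintegral => t _.
  by rewrite /G !(Re_mul, Im_mul)/= -/(row t); ring.
Qed.

(** The function exp (i s v.w) (dF + i s w_j F) is the j-th partial derivative
    of exp (i s v.w) F, so its integral vanishes. *)
Lemma ftransform_partial F dF s w j :
  crapid F -> crapid dF ->
  (forall v, is_derive v (delta_mx 0 j) (fun v => Re (F v)) (Re (dF v))) ->
  (forall v, is_derive v (delta_mx 0 j) (fun v => Im (F v)) (Im (dF v))) ->
  (forall v, continuous (fun h : R => Re (F (v + h *: delta_mx 0 j)))) ->
  (forall v, continuous (fun h : R => Im (F (v + h *: delta_mx 0 j)))) ->
  (forall v, continuous (fun h : R => Re (dF (v + h *: delta_mx 0 j)))) ->
  (forall v, continuous (fun h : R => Im (dF (v + h *: delta_mx 0 j)))) ->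
  ftransform s dF w = - ('i * (s * w 0 j)%:C) * ftransform s F w.
Proof.
move=> cF cdF dRe dIm cRe cIm cdRe cdIm.
pose E v := cexpi (s * dot v w) : R[i].
pose P v := E v * F v.
pose c := 'i * (s * w 0 j)%:C.
(* Q is the partial derivative of P *)
pose Q v := E v * dF v + c * P v.
have cP : crapid P by exact: crapid_cexpi.
have cEdF : crapid (fun v => E v * dF v) by exact: crapid_cexpi.
have cQ : crapid Q by apply: crapidD => //; exact: crapidZ.
suff Q0 : cintegral Q = 0.
  have := Q0; rewrite /Q cintegralD; [|exact: crapid_integrable..|]; last first.
    exact/crapid_integrable/crapidZ.
  rewrite cintegralZ; last exact: crapid_integrable.
  by move=> /eqP; rewrite addr_eq0 -mulNr => /eqP.
have dotline v h : dot (v + h *: delta_mx 0 j) w = dot v w + h * w 0 j.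
  by rewrite dotC dotD dot_delta dotC.
have dcos v (h : R) : is_derive h 1
   (fun h : R => cos (s * dot (v + h *: delta_mx 0 j) w))
   (- (s * w 0 j) * sin (s * dot (v + h *: delta_mx 0 j) w)).
  apply: eq_is_derive (is_derive_trig 1 0 (s * dot v w) (s * w 0 j) h).
    by move=> k; rewrite dotline mul1r mul0r addr0 mulrDr mulrCA.
  by rewrite dotline mul1r mul0r sub0r mulrDr mulrCA mulrN mulNr.
have dsin v (h : R) : is_derive h 1
   (fun h : R => sin (s * dot (v + h *: delta_mx 0 j) w))
   ((s * w 0 j) * cos (s * dot (v + h *: delta_mx 0 j) w)).
  apply: eq_is_derive (is_derive_trig 0 1 (s * dot v w) (s * w 0 j) h).
    by move=> k; rewrite dotline mul1r mul0r add0r mulrDr mulrCA.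
  by rewrite dotline mul1r mul0r subr0 mulrDr mulrCA.
have contd (f df : R -> R) :
    (forall h : R, is_derive h 1 f (df h)) -> continuous f.
  by move=> fd x; apply: differentiable_continuous; apply/derivable1_diffP; exact: ex_derive.
have ccos v := contd _ _ (dcos v).
have csin v := contd _ _ (dsin v).
have cE (G : 'rV[R]_n -> R[i]) v :
    continuous (fun h : R => Re (G (v + h *: delta_mx 0 j))) ->
    continuous (fun h : R => Im (G (v + h *: delta_mx 0 j))) ->
    continuous (fun h : R => Re (E (v + h *: delta_mx 0 j) *
                                 G (v + h *: delta_mx 0 j))) /\
    continuous (fun h : R => Im (E (v + h *: delta_mx 0 j) *
                                 G (v + h *: delta_mx 0 j))).
  move=> cr ci; split.
    under eq_fun do rewrite Re_mul; move=> h.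
    exact: cvgB (cvgM (ccos v h) (cr h)) (cvgM (csin v h) (ci h)).
  under eq_fun do rewrite Im_mul; move=> h.
  exact: cvgD (cvgM (ccos v h) (ci h)) (cvgM (csin v h) (cr h)).
have cPl v := cE F v (cRe v) (cIm v).
have cEdFl v := cE dF v (cdRe v) (cdIm v).
have cQRe v : continuous (fun h : R => Re (Q (v + h *: delta_mx 0 j))).
  rewrite /Q; under eq_fun do rewrite Re_add (Re_mul c).
  move=> h; apply: cvgD; first exact: (cEdFl v).1 h.
  exact: cvgB (cvgMl_tmp ((cPl v).1 h)) (cvgMl_tmp ((cPl v).2 h)).
have cQIm v : continuous (fun h : R => Im (Q (v + h *: delta_mx 0 j))).
  rewrite /Q; under eq_fun do rewrite Im_add (Im_mul c).
  move=> h; apply: cvgD; first exact: (cEdFl v).2 h.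
  exact: cvgD (cvgMl_tmp ((cPl v).2 h)) (cvgMl_tmp ((cPl v).1 h)).
have [M1 M1P] : exists M, forall v, `|Re (P v)| <= M * weight v by exact/decays_weight/cP.1.2.
have [M2 M2P] : exists M, forall v, `|Im (P v)| <= M * weight v by exact/decays_weight/cP.2.2.
have [M3 M3P] : exists M, forall v, `|Re (Q v)| <= M * weight v by exact/decays_weight/cQ.1.2.
have [M4 M4P] : exists M, forall v, `|Im (Q v)| <= M * weight v by exact/decays_weight/cQ.2.2.
have maxP (x y : R) v z : `|z| <= x * weight v -> `|z| <= Num.max x y * weight v.
  by move=> /le_trans; apply; rewrite ler_wpM2r ?le_max ?lexx// ltW// weight_gt0.
have maxP2 (x y : R) v z : `|z| <= y * weight v -> `|z| <= Num.max x y * weight v.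
  by rewrite maxC; exact: maxP.
apply: complex_eq; rewrite /cintegral /= /Rintegral.
- suff -> : (\int[lebt]_t (Re (Q (row t)))%:E = 0)%E by [].
  apply: (@integral_partial_eq0 _ _ j (fun v => Re (P v)) (fun v => Re (Q v)) (Num.max M1 M3)).
  + move=> v.
    have dR := (is_derive_line _ _ _ _).2 (dRe v).
    have dI := (is_derive_line _ _ _ _).2 (dIm v).
    apply: (eq_is_derive _ _ (is_deriveB (is_deriveM (dcos v 0) dR) (is_deriveM (dsin v 0) dI))).
      by move=> h; rewrite /P Re_mul.
    rewrite scale0r addr0 -![_ *: _]/(_ * _).
    rewrite /Q /P /c Re_add !(Re_mul, Im_mul)/=; ring.
  + exact: cQRe.
  + exact: cQ.1.1.
  + by move=> v; exact: maxP.
  + by move=> v; exact: maxP2.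
- suff -> : (\int[lebt]_t (Im (Q (row t)))%:E = 0)%E by [].
  apply: (@integral_partial_eq0 _ _ j (fun v => Im (P v)) (fun v => Im (Q v)) (Num.max M2 M4)).
  + move=> v.
    have dR := (is_derive_line _ _ _ _).2 (dRe v).
    have dI := (is_derive_line _ _ _ _).2 (dIm v).
    apply: (eq_is_derive _ _ (is_deriveD (is_deriveM (dcos v 0) dI) (is_deriveM (dsin v 0) dR))).
      by move=> h; rewrite /P Im_mul.
    rewrite scale0r addr0 -![_ *: _]/(_ * _).
    rewrite /Q /P /c Im_add !(Re_mul, Im_mul)/=; ring.
  + exact: cQIm.
  + exact: cQ.2.1.
  + by move=> v; exact: maxP.
  + by move=> v; exact: maxP2.
Qed.

End TransformDerivative.

(** * Coordinates on the group *)

Section LinearFunction.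
Context (K : pzRingType) (U V : lmodType K) (f : U -> V) (f_linear : linear f).

Lemma linear_fun0 : f 0 = 0.
Proof.
have := f_linear 1 0 0; rewrite !scale1r addr0 => /eqP.
by rewrite -subr_eq subrr eq_sym => /eqP.
Qed.

Lemma linear_funZ c u : f (c *: u) = c *: f u.
Proof. by have := f_linear c u 0; rewrite linear_fun0 !addr0. Qed.

Lemma linear_funD u v : f (u + v) = f u + f v.
Proof. by have := f_linear 1 u v; rewrite !scale1r. Qed.

Lemma linear_funN u : f (- u) = - f u.
Proof. by rewrite -scaleN1r linear_funZ scaleN1r. Qed.

Lemma linear_fun_lincomb (I : Type) (s : seq I) (c : I -> K) (e : I -> U) :
  f (\sum_(i <- s) c i *: e i) = \sum_(i <- s) c i *: f (e i).
Proof.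
by elim: s => [|i s IH]; rewrite ?big_nil ?linear_fun0// !big_cons f_linear IH.
Qed.

End LinearFunction.

Section LieCoordinates.
Context (R : realType) (g : vectType R) (d : nat) (X : d.-tuple g).
Context (br : g -> g -> g).
Context (X_basis : basis_of fullv X) (br_lie : lie_bracket br).
Context (br_two_step : two_step br).
Implicit Types (v w x y : 'rV[R]_d) (xi : dual g).

Lemma free_basis : free X. Proof. exact: basis_free X_basis. Qed.

Lemma coord_tnth i j : coord X i (tnth X j) = (j == i)%:R.
Proof. by rewrite (tnth_nth 0) coord_free ?free_basis. Qed.

Lemma coord_point v k : coord X k (Defs.point X v) = v 0 k.
Proof.
rewrite /Defs.point; under eq_bigr do rewrite (tnth_nth 0).
by rewrite coord_sum_free ?free_basis.
Qed.

Lemma point_coord z : Defs.point X (\row_k coord X k z) = z.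
Proof.
rewrite {2}(coord_basis X_basis (memvf z)).
by apply: eq_bigr => k _; rewrite mxE (tnth_nth 0).
Qed.

Lemma dual_point xi w : xi (Defs.point X w) = dot w (dual_coord X xi) :> R.
Proof.
rewrite /Defs.point linear_sum; apply: eq_bigr => i _.
by rewrite linearZ mxE.
Qed.

Lemma dual_coord_covector v : dual_coord X (covector X v) = v.
Proof.
apply/rowP => k; rewrite mxE /covector sum_lfunE (bigD1 k)//= big1 ?addr0.
  by rewrite scale_lfunE lfunE/= coord_tnth eqxx [LHS]mulr1.
move=> i /negPf ik; rewrite scale_lfunE lfunE/= coord_tnth eq_sym ik.
by rewrite [LHS]mulr0.
Qed.

Lemma bracket_point x y :
  br (Defs.point X x) (Defs.point X y) =
  \sum_i \sum_j (x 0 i * y 0 j) *: br (tnth X i) (tnth X j).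
Proof.
have [brl brr _ _] := br_lie.
rewrite [X in br X _]/Defs.point (linear_fun_lincomb (brr _)); apply: eq_bigr => i _.
rewrite /Defs.point (linear_fun_lincomb (brl _)) scaler_sumr; apply: eq_bigr => j _.
by rewrite scalerA.
Qed.

Lemma coord_bracket x y k :
  coord X k (br (Defs.point X x) (Defs.point X y)) =
  \sum_(t : triples X br | (val t).2 == k)
    struct_const X br (val t).1.1 (val t).1.2 (val t).2 *
    (x 0 (val t).1.1 * y 0 (val t).1.2).
Proof.
rewrite bracket_point linear_sum/=.
under eq_bigr do rewrite linear_sum/=.
under eq_bigr do under eq_bigr do rewrite linearZ/= -/(struct_const X br _ _ k).
rewrite pair_big/=.
rewrite [RHS](_ : _ = \sum_(t in [pred t : 'I_d * 'I_d * 'I_d |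
    struct_const X br t.1.1 t.1.2 t.2 != 0] | t.2 == k)
    struct_const X br t.1.1 t.1.2 t.2 * (x 0 t.1.1 * y 0 t.1.2)); last first.
  by rewrite big_sub_cond.
rewrite big_mkcondl/=.
transitivity (\sum_(t : 'I_d * 'I_d * 'I_d | t.2 == k)
    struct_const X br t.1.1 t.1.2 t.2 * (x 0 t.1.1 * y 0 t.1.2)).
  rewrite -(pair_big xpredT (pred1 k) (fun (p : 'I_d * 'I_d) l =>
    struct_const X br p.1 p.2 l * (x 0 p.1 * y 0 p.2)))/=.
  by apply: eq_bigr => p _; rewrite big_pred1_eq mulrC.
apply: eq_bigr => t _; rewrite inE; case: eqP => //= ->.
by rewrite mul0r.
Qed.

(** The coordinates of x o y^-1. *)
Definition rdiv_coord x y : 'rV[R]_d :=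
  \row_k coord X k (ch_mul br (Defs.point X x) (- Defs.point X y)).

Lemma point_rdiv_coord x y :
  Defs.point X (rdiv_coord x y) = ch_mul br (Defs.point X x) (- Defs.point X y).
Proof. exact: point_coord. Qed.

(** The correction terms are brackets of a bracket with y, which vanish in a
    two-step algebra. *)
Lemma rdiv_coord_ch_mul x y :
  ch_mul br (Defs.point X (rdiv_coord x y)) (Defs.point X y) = Defs.point X x.
Proof.
have [brl brr brxx _] := br_lie.
have addl a b c : br (a + b) c = br a c + br b c := linear_funD (brr c) a b.
have scalel c a b : br (c *: a) b = c *: br a b := linear_funZ (brr b) c a.
have oppl a b : br (- a) b = - br a b := linear_funN (brr b) a.
have oppr a b : br a (- b) = - br a b := linear_funN (brl a) b.
have brC a b : br a b = - br b a.
  apply/eqP; rewrite -addr_eq0; apply/eqP.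
  have := brxx (a + b).
  by rewrite addl !(linear_funD (brl _)) !brxx add0r addr0.
rewrite point_rdiv_coord /ch_mul !addl scalel oppl brxx oppr0 addr0.
rewrite [br (br _ _) _]brC br_two_step oppr0 scaler0 addr0 oppr scalerN.
by rewrite -addrA addrA addrAC addrNK subrK.
Qed.

End LieCoordinates.

Section Quotient.
Context (R : realType) (g : vectType R) (d : nat) (X : d.-tuple g).
Context (br : g -> g -> g).
Context (X_basis : basis_of fullv X) (br_lie : lie_bracket br).
Context (br_two_step : two_step br).
Implicit Types (x y : 'rV[R]_d).
Local Notation T := (measurableTypeR R).
Local Notation row := (@tuple_row R d).
Local Notation rdiv_coord := (rdiv_coord X br).

Lemma coord_rdiv_coord x y k : rdiv_coord x y 0 k = x 0 k - y 0 k -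
  2^-1 * \sum_(t : triples X br | (val t).2 == k)
    struct_const X br (val t).1.1 (val t).1.2 (val t).2 *
    (x 0 (val t).1.1 * y 0 (val t).1.2).
Proof.
rewrite mxE /ch_mul !linearD/= linearZ/= linearN/= !coord_point//.
have [brl _ _ _] := br_lie.
rewrite (linear_funN (brl _)).
by rewrite linearN/= coord_bracket// mulrN.
Qed.

(** The relation x = z o y with z = x o y^-1, in coordinates and in the form
    required by [monomial_ch_mul]. *)
Lemma rdiv_coord_mul x y k : x 0 k = rdiv_coord x y 0 k + y 0 k +
  \sum_(t : triples X br | (val t).2 == k)
    2^-1 * struct_const X br (val t).1.1 (val t).1.2 (val t).2 *
    (rdiv_coord x y 0 (val t).1.1 * y 0 (val t).1.2).
Proof.
rewrite -{1}(coord_point X_basis x k) -(rdiv_coord_ch_mul X_basis br_lie br_two_step x y).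
rewrite /ch_mul !linearD/= linearZ/= !coord_point// coord_bracket//.
by congr (_ + _); rewrite [LHS]mulr_sumr; apply: eq_bigr => t _; rewrite [LHS]mulrA.
Qed.

Lemma measurable_rdiv_coord k : measurable_fun setT
  (fun p : d.-tuple T * d.-tuple T => rdiv_coord (row p.1) (row p.2) 0 k).
Proof.
under eq_fun do rewrite coord_rdiv_coord.
have m1 i : measurable_fun setT (fun p : d.-tuple T * d.-tuple T => row p.1 0 i).
  exact: (measurableT_comp (measurable_coord i)).
have m2 i : measurable_fun setT (fun p : d.-tuple T * d.-tuple T => row p.2 0 i).
  exact: (measurableT_comp (measurable_coord i)).
apply: measurable_funB; first exact: measurable_funB.
apply: measurable_funM => //.
under eq_fun do rewrite big_mkcond.
apply: measurable_sum => t; case: eqP => // _.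
by apply: measurable_funM => //; exact: measurable_funM.
Qed.

Lemma measurable_comp_rdiv_coord (u : 'rV[R]_d -> R) :
  measurable_fun setT (u \o row) ->
  measurable_fun setT
    (fun p : d.-tuple T * d.-tuple T => u (rdiv_coord (row p.1) (row p.2))).
Proof.
move=> mu.
pose q (p : d.-tuple T * d.-tuple T) : d.-tuple T :=
  [tuple rdiv_coord (row p.1) (row p.2) 0 k | k < d].
have mq : measurable_fun setT q.
  apply/measurable_fun_tnthP => k.
  rewrite (_ : _ \o _ = fun p => rdiv_coord (row p.1) (row p.2) 0 k).
    exact: measurable_rdiv_coord.
  by apply/funext => p /=; rewrite tnth_mktuple.
rewrite (_ : (fun p => _) = (u \o row) \o q); first exact: measurableT_comp.
apply/funext => p /=; congr u; apply/rowP => k.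
by rewrite !mxE tnth_mktuple mxE.
Qed.

End Quotient.

(** * Convolution *)

Section Convolution.
Context (R : realType) (g : vectType R) (d : nat) (X : d.-tuple g).
Context (br : g -> g -> g).
Context (X_basis : basis_of fullv X) (br_lie : lie_bracket br).
Context (br_two_step : two_step br).
Implicit Types (x y : 'rV[R]_d) (F H : 'rV[R]_d -> R[i]).
Local Notation T := (measurableTypeR R).
Local Notation row := (@tuple_row R d).
Local Notation rdiv_coord := (rdiv_coord X br).
Local Notation Re := complex.Re.
Local Notation Im := complex.Im.

Definition coord_conv F H x : R[i] := cintegral (fun y => F (rdiv_coord x y) * H y).

Lemma rapid_bounded (u : 'rV[R]_d -> R) : rapid u -> exists M, forall v, `|u v| <= M.
Proof.
move=> [_ /(_ 0)[M h]]; exists M => v; have := h v.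
by rewrite /monomial big1 ?mul1r// => i _; rewrite ffunE expr0.
Qed.

Lemma crapid_bounded F : crapid F ->
  exists M, forall v, `|Re (F v)| <= M /\ `|Im (F v)| <= M.
Proof.
move=> [/rapid_bounded[M1 h1] /rapid_bounded[M2 h2]].
exists (Num.max M1 M2) => v; split.
- by rewrite (le_trans (h1 v))// le_max lexx.
- by rewrite (le_trans (h2 v))// le_max lexx orbT.
Qed.

Lemma crapid_convolute F H x : crapid F -> crapid H ->
  crapid (fun y => F (rdiv_coord x y) * H y).
Proof.
move=> cF; have [M h] := crapid_bounded cF; have [[mr _] [mi _]] := cF.
pose tx : d.-tuple T := [tuple x 0 k | k < d].
have rx : row tx = x by apply/rowP => k; rewrite !mxE tnth_mktuple.
apply: (crapidM (M := M)).
- have := measurableT_comp (measurable_comp_rdiv_coord X_basis br_lie mr) (pair1_measurable tx).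
  by rewrite /comp/= rx.
- have := measurableT_comp (measurable_comp_rdiv_coord X_basis br_lie mi) (pair1_measurable tx).
  by rewrite /comp/= rx.
- by move=> y; have [] := h (rdiv_coord x y).
- by move=> y; have [] := h (rdiv_coord x y).
Qed.

Lemma measurable_coord_conv F H : crapid F -> crapid H ->
  measurable_fun setT (fun t => Re (coord_conv F H (row t))) /\
  measurable_fun setT (fun t => Im (coord_conv F H (row t))).
Proof.
move=> [[mr _] [mi _]] [[nr _] [ni _]].
have mr2 := measurable_comp_rdiv_coord X_basis br_lie mr.
have mi2 := measurable_comp_rdiv_coord X_basis br_lie mi.
have nr2 : measurable_fun setT (fun p : d.-tuple T * d.-tuple T => Re (H (row p.2))).
  exact: (measurableT_comp nr).
have ni2 : measurable_fun setT (fun p : d.-tuple T * d.-tuple T => Im (H (row p.2))).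
  exact: (measurableT_comp ni).
apply: measurable_cintegral_param.
- under eq_fun do rewrite Re_mul.
  by apply: measurable_funB; exact: measurable_funM.
- under eq_fun do rewrite Im_mul.
  by apply: measurable_funD; exact: measurable_funM.
Qed.

Lemma coord_conv_bounded F H : crapid F -> crapid H ->
  exists M, forall x, `|Re (coord_conv F H x)| <= M /\ `|Im (coord_conv F H x)| <= M.
Proof.
move=> cF cH; have [M h] := crapid_bounded cF.
have M0 : 0 <= M by have [h0 _] := h 0; exact: le_trans h0.
have iH := integrable_ReIm cH.
eexists => x; apply: (@le_cintegral _ _ _ (fun y => M * (`|Re (H y)| + `|Im (H y)|))).
- exact/crapid_integrable/crapid_convolute.
- exact: (integrableZl measurableT M iH).
- move=> y; have [h1 h2] := h (rdiv_coord x y).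
  by rewrite Re_mul (le_trans (ler_normB _ _))// !normrM mulrDr lerD// ler_wpM2r.
- move=> y; have [h1 h2] := h (rdiv_coord x y).
  by rewrite Im_mul addrC (le_trans (ler_normD _ _))// !normrM mulrDr lerD// ler_wpM2r.
Qed.

(** Under the integral sign, x^a is expanded in monomials of x o y^-1 and y,
    the arguments of F and H. *)
Lemma monomial_coord_conv F H a x : crapid F -> crapid H ->
  (monomial x a)%:C * coord_conv F H x =
  \sum_(p <- finmap.enum_fset (fset_set (@decompositions R g d X br a)))
    (multi_binom a p.1.1 p.2 * c_sigma p.2)%:C *
    coord_conv (fun z => (monomial z (p.1.1 + sigma1 p.2))%:C * F z)
          (fun y => (monomial y (p.1.2 + sigma2 p.2))%:C * H y) x.
Proof.
move=> cF cH.
have [_ <-] := @cintegral_sum R d _ (finmap.enum_fset (fset_set (@decompositions R g d X br a)))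
   (fun p => (multi_binom a p.1.1 p.2 * c_sigma p.2)%:C)
   (fun p y => (monomial (rdiv_coord x y) (p.1.1 + sigma1 p.2))%:C * F (rdiv_coord x y) *
     ((monomial y (p.1.2 + sigma2 p.2))%:C * H y))
   (fun p => crapid_convolute x (crapid_monomialM _ cF) (crapid_monomialM _ cH)).
rewrite -cintegralZ; last exact/crapid_integrable/crapid_convolute.
congr cintegral; apply/funext => y.
rewrite (monomial_ch_mul a (rdiv_coord_mul X_basis br_lie br_two_step x y)).
rewrite fsbig_finite; last exact: decompositions_finite.
rewrite rmorph_sum mulr_suml; apply: eq_bigr => p _.
rewrite /= !rmorphM/=; ring.
Qed.

(** By [monomial_coord_conv], a monomial times a convolution is a finite sum
    of convolutions of rapidly decreasing functions, which are bounded. *)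
Lemma crapid_coord_conv F H : crapid F -> crapid H -> crapid (coord_conv F H).
Proof.
move=> cF cH; have [m1 m2] := measurable_coord_conv cF cH.
suff bnd (a : {ffun 'I_d -> nat}) : exists M, forall x,
    `|Re ((monomial x a)%:C * coord_conv F H x)| <= M /\
    `|Im ((monomial x a)%:C * coord_conv F H x)| <= M.
  split; split => // a; have [M h] := bnd a; exists M => x.
    by have [+ _] := h x; rewrite Re_mul/= mul0r subr0.
  by have [_ +] := h x; rewrite Im_mul/= mul0r addr0.
under eq_exists do under eq_forall do rewrite monomial_coord_conv//.
elim: (finmap.enum_fset _) => [|p s [M IH]].
  by exists 0 => x; rewrite big_nil normr0.
have [N h] := coord_conv_bounded (crapid_monomialM (p.1.1 + sigma1 p.2) cF)
                            (crapid_monomialM (p.1.2 + sigma2 p.2) cH).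
exists (`|multi_binom a p.1.1 p.2 * c_sigma p.2| * N + M) => x.
have [h1 h2] := h x; have [k1 k2] := IH x.
rewrite big_cons Re_add Im_add !(Re_mul, Im_mul)/= !mul0r subr0 addr0; split.
- by rewrite (le_trans (ler_normD _ _))// lerD// normrM ler_wpM2l.
- by rewrite (le_trans (ler_normD _ _))// lerD// normrM ler_wpM2l.
Qed.

End Convolution.

(** * Schwartz functions on the dual space *)

Section MultiIter.
Context (J : eqType).
Implicit Types (b : J -> nat) (L : seq J).

(** The order in which [multi_iter] applies the operators; in this form an
    iterated operator can be peeled off one letter at a time. *)
Definition block_word b L := flatten [seq nseq (b j) j | j <- L].

Lemma foldr_block_word (A : Type) (op : J -> A -> A) (f : A) b L :
  foldr (fun j => iter (b j) (op j)) f L = foldr op f (block_word b L).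
Proof.
elim: L => [//|j L IH] /=; rewrite /block_word/= foldr_cat -/(block_word b L) -IH.
by elim: (b j) => //= k ->.
Qed.

(** The intermediate functions met when computing D^b f one derivative at a
    time are again derivatives taken in the standard order, to which the
    Schwartz bounds apply. *)
Lemma block_word_behead b L j s : uniq L -> block_word b L = j :: s ->
  exists b', s = block_word b' L.
Proof.
elim: L s => [//|l L IH] s /= /andP[lL uL]; rewrite /block_word/= -/(block_word b L).
have eqL (b1 b2 : J -> nat) : {in L, b1 =1 b2} -> block_word b1 L = block_word b2 L.
  by move=> e; rewrite /block_word; congr flatten; apply/eq_in_map => i iL; rewrite e.
case bl : (b l) => [|k] /=.
  move=> /(IH _ uL)[b' ->]; exists (fun i => if i == l then 0%N else b' i).
  rewrite /block_word/= eqxx/= -/(block_word _ L); apply: eqL => i iL.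
  by case: eqP iL lL => // -> ->.
move=> [_ <-]; exists (fun i => if i == l then k else b i).
rewrite /block_word/= eqxx -!/(block_word _ L); congr cat; apply: eqL => i iL.
by case: eqP iL lL => // -> ->.
Qed.

End MultiIter.

Section Dual.
Context (R : realType) (g : vectType R) (d : nat) (X : d.-tuple g).
Context (X_basis : basis_of fullv X).
Implicit Types (v w : 'rV[R]_d) (f u : dual g -> R[i]) (xi : dual g).
Local Notation T := (measurableTypeR R).
Local Notation row := (@tuple_row R d).
Local Notation Re := complex.Re.
Local Notation Im := complex.Im.
Local Notation cov := (covector X).

Lemma multi_iter_block_word op (b : {ffun 'I_d -> nat}) f :
  multi_iter op b f = foldr op f (block_word b (enum 'I_d)).
Proof. exact: foldr_block_word. Qed.

Lemma prod_block_word w (b : {ffun 'I_d -> nat}) :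
  \prod_(j <- block_word b (enum 'I_d)) w 0 j = monomial w b.
Proof.
rewrite /block_word big_flatten/= big_map big_enum/=; apply: eq_bigr => j _.
by rewrite big_nseq; elim: (b j) => //= k ->; rewrite exprS.
Qed.

Lemma partialZ j u (c : R[i]) xi :
  derivable (fun v => Re (u (cov v))) (dual_coord X xi) (delta_mx 0 j) ->
  derivable (fun v => Im (u (cov v))) (dual_coord X xi) (delta_mx 0 j) ->
  partial X j (fun xi => c * u xi) xi = c * partial X j u xi.
Proof.
move=> /derivableP dr /derivableP di; apply: complex_eq; rewrite /partial/=.
- rewrite Re_mul/=; apply: derive_val.
  apply: (eq_is_derive _ _ (is_deriveB (is_deriveZ (Re c) dr) (is_deriveZ (Im c) di))) => //.
  by move=> v /=; rewrite Re_mul.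
- rewrite Im_mul/=; apply: derive_val.
  apply: (eq_is_derive _ _ (is_deriveD (is_deriveZ (Re c) di) (is_deriveZ (Im c) dr))) => //.
  by move=> v /=; rewrite Im_mul.
Qed.

Lemma Dpart_block_word f s : smooth X f ->
  foldr (Dpart X) f s = fun xi => 'i ^+ size s * foldr (partial X) f s xi.
Proof.
move=> sf; elim: s => [|j s IH] /=; first by apply/funext => xi; rewrite expr0 mul1r.
apply/funext => xi; rewrite IH /Dpart partialZ ?exprS ?mulrA//.
- by apply: diff_derivable; have [] := sf s (dual_coord X xi).
- by apply: diff_derivable; have [] := sf s (dual_coord X xi).
Qed.

Lemma le_normc_ReIm (z : R[i]) (M : R) : `|z| <= M%:C -> `|Re z| <= M /\ `|Im z| <= M.
Proof.
rewrite normc_def lecR => zM; split; apply: le_trans zM.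
- by rewrite -sqrtr_sqr ler_wsqrtr// lerDl sqr_ge0.
- by rewrite -sqrtr_sqr ler_wsqrtr// lerDr sqr_ge0.
Qed.

Lemma crapid_block_word f (b : 'I_d -> nat) : schwartz X f ->
  crapid (fun v => foldr (partial X) f (block_word b (enum 'I_d)) (cov v)).
Proof.
move=> [sf bf]; set s := block_word b (enum 'I_d).
have [cr ci] : continuous (fun v => Re (foldr (partial X) f s (cov v))) /\
    continuous (fun v => Im (foldr (partial X) f s (cov v))).
  by split=> v; apply: differentiable_continuous; have [] := sf s v.
have bE : s = block_word [ffun i => b i] (enum 'I_d).
  by rewrite /s /block_word; congr flatten; apply: eq_map => i; rewrite ffunE.
have bnd a : exists M, forall v,
    `|monomial v a * Re (foldr (partial X) f s (cov v))| <= M /\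
    `|monomial v a * Im (foldr (partial X) f s (cov v))| <= M.
  have [M h] := bf a [ffun i => b i]; exists M => v.
  have /le_normc_ReIm := h (cov v).
  rewrite multi_iter_block_word -bE dual_coord_covector// -/(monomial v a).
  by rewrite Re_mul Im_mul/= !mul0r subr0 addr0.
split; split.
- exact: continuous_measurable_tuple_row cr.
- by move=> a; have [M h] := bnd a; exists M => v; have [] := h v.
- exact: continuous_measurable_tuple_row ci.
- by move=> a; have [M h] := bnd a; exists M => v; have [] := h v.
Qed.

Lemma continuous_line (q : 'rV[R]_d -> R) v j :
  continuous q -> continuous (fun h : R => q (v + h *: delta_mx 0 j)).
Proof.
move=> cq h; apply: (@cvg_comp _ _ _ (fun h : R => v + h *: delta_mx 0 j) q _
  (nbhs (v + h *: delta_mx 0 j))); last exact: cq.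
by apply: cvgD; [exact: cvg_cst|apply: cvgZr_tmp; exact: cvg_id].
Qed.

(** Each derivative is moved onto the exponential by parts: the factor i of D_j
    and the factor -i w_j from [ftransform_partial] multiply to w_j. *)
Lemma ftransform_block_word f (b : 'I_d -> nat) w : schwartz X f ->
  ftransform 1 (fun v => foldr (Dpart X) f (block_word b (enum 'I_d)) (cov v)) w =
  (\prod_(j <- block_word b (enum 'I_d)) w 0 j)%:C * ftransform 1 (fun v => f (cov v)) w.
Proof.
move=> fS; have [sf _] := fS.
have [s sE] : exists s, s = block_word b (enum 'I_d) by eexists.
rewrite -sE; elim: s b sE => [|j s IH] b sE.
  by rewrite big_nil mul1r.
have [b' sb'] := block_word_behead (enum_uniq 'I_d) (esym sE).
have c1 : crapid (fun v => foldr (partial X) f (j :: s) (cov v)).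
  by rewrite sE; exact: crapid_block_word.
have c2 : crapid (fun v => foldr (partial X) f s (cov v)).
  by rewrite sb'; exact: crapid_block_word.
have cl t :
    (forall v, continuous (fun h : R =>
       Re (foldr (partial X) f t (cov (v + h *: delta_mx 0 j))))) /\
    (forall v, continuous (fun h : R =>
       Im (foldr (partial X) f t (cov (v + h *: delta_mx 0 j))))).
  split=> v.
    apply: (@continuous_line (fun v => Re (foldr (partial X) f t (cov v)))) => w'.
    by apply: differentiable_continuous; have [] := sf t w'.
  apply: (@continuous_line (fun v => Im (foldr (partial X) f t (cov v)))) => w'.
  by apply: differentiable_continuous; have [] := sf t w'.
have [cs1 cs2] := cl s; have [cj1 cj2] := cl (j :: s).
have d1 v : is_derive v (delta_mx 0 j) (fun v => Re (foldr (partial X) f s (cov v)))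
    (Re (foldr (partial X) f (j :: s) (cov v))).
  apply: DeriveDef; last by rewrite /= /partial/= dual_coord_covector.
  by apply: diff_derivable; have [] := sf s v.
have d2 v : is_derive v (delta_mx 0 j) (fun v => Im (foldr (partial X) f s (cov v)))
    (Im (foldr (partial X) f (j :: s) (cov v))).
  apply: DeriveDef; last by rewrite /= /partial/= dual_coord_covector.
  by apply: diff_derivable; have [] := sf s v.
have ibp := @ftransform_partial R d _ _ 1 w j c2 c1 d1 d2 cs1 cs2 cj1 cj2.
have DE t : (fun v => foldr (Dpart X) f t (cov v)) =
    (fun v => 'i ^+ size t * foldr (partial X) f t (cov v)) by rewrite Dpart_block_word.
rewrite (DE (j :: s)) big_cons rmorphM -mulrA -(IH b')// (DE s).
rewrite (ftransformZ _ _ _ c1) (ftransformZ _ _ _ c2) ibp.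
rewrite mul1r exprS; set k := 'i ^+ _; set Z := ftransform _ _ _.
rewrite [LHS](_ : _ = - ('i ^+ 2) * ((w 0 j)%:C * (k * Z))); last by ring.
by rewrite sqr_i opprK mul1r.
Qed.

Lemma ftransform_Dmulti f (b : {ffun 'I_d -> nat}) w : schwartz X f ->
  ftransform 1 (fun v => Dmulti X b f (cov v)) w =
  (monomial w b)%:C * ftransform 1 (fun v => f (cov v)) w.
Proof.
move=> fS; rewrite -prod_block_word -ftransform_block_word//.
by congr ftransform; apply/funext => v; rewrite /Dmulti multi_iter_block_word.
Qed.

Lemma crapid_Dmulti f (b : {ffun 'I_d -> nat}) : schwartz X f ->
  crapid (fun v => Dmulti X b f (cov v)).
Proof.
move=> fS; rewrite /Dmulti multi_iter_block_word Dpart_block_word; last exact: fS.1.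
exact/crapidZ/crapid_block_word.
Qed.

Lemma schwartz_crapid f : schwartz X f -> crapid (fun v => f (cov v)).
Proof.
move=> /(crapid_Dmulti 0); rewrite /Dmulti multi_iter_block_word.
suff -> : block_word (0 : {ffun 'I_d -> nat}) (enum 'I_d) = [::] by [].
by rewrite /block_word; elim: (enum _) => //= i s ->; rewrite ffunE.
Qed.

(** By [ftransform_Dmulti], a monomial times the inverse transform of f is the
    inverse transform of a derivative of f, hence bounded. *)
Lemma crapid_ftransform f : schwartz X f -> crapid (ftransform 1 (fun v => f (cov v))).
Proof.
move=> fS; have [m1 m2] := ftransform_measurable 1 (schwartz_crapid fS).
have bnd (a : {ffun 'I_d -> nat}) : exists M, forall w,
    `|monomial w a * Re (ftransform 1 (fun v => f (cov v)) w)| <= M /\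
    `|monomial w a * Im (ftransform 1 (fun v => f (cov v)) w)| <= M.
  have [M h] := ftransform_bounded 1 (crapid_Dmulti a fS); exists M => w.
  by have := h w; rewrite ftransform_Dmulti// Re_mul Im_mul/= !mul0r subr0 addr0.
split; split => // a; have [M h] := bnd a; exists M => w; by have [] := h w.
Qed.

Lemma inv_fourier_point cxi f w :
  inv_fourier X cxi f (Defs.point X w) = cxi%:C * ftransform 1 (fun v => f (cov v)) w.
Proof.
rewrite /inv_fourier /integral_dual /ftransform; congr (_ * cintegral _).
apply/funext => v; congr (cexpi _ * _).
by rewrite dual_point dual_coord_covector// mul1r dotC.
Qed.

(** Each D_j brings a factor i (-i v_j) = v_j under the integral sign. *)
Lemma foldr_Dpart_ftransform (c : R[i]) (G : 'rV[R]_d -> R[i]) s : crapid G ->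
  foldr (Dpart X) (fun xi => c * ftransform (-1) G (dual_coord X xi)) s =
  fun xi => c * ftransform (-1) (fun v => (\prod_(j <- s) v 0 j)%:C * G v) (dual_coord X xi).
Proof.
move=> cG.
suff [] : crapid (fun v => (\prod_(j <- s) v 0 j)%:C * G v) /\
  foldr (Dpart X) (fun xi => c * ftransform (-1) G (dual_coord X xi)) s =
  fun xi => c * ftransform (-1) (fun v => (\prod_(j <- s) v 0 j)%:C * G v) (dual_coord X xi) by [].
elim: s => [|j s [cs IH]].
  by under eq_fun do rewrite big_nil mul1r; split => //=; under eq_fun do rewrite big_nil mul1r.
set Gs := fun v => _ in cs IH.
have consE : (fun v => (\prod_(i <- j :: s) v 0 i)%:C * G v) =
    (fun v => (monomial v (unit_multi j))%:C * Gs v).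
  by apply/funext => v; rewrite big_cons monomial_unit rmorphM mulrA.
have cjs : crapid (fun v => (monomial v (unit_multi j))%:C * Gs v) by exact: crapid_monomialM.
rewrite consE; split => //=; rewrite IH; apply/funext => xi.
have [dR dI] := is_derive_ftransform (-1) (dual_coord X xi) j cs.
rewrite /Dpart partialZ; last 2 first.
- by under eq_fun do rewrite dual_coord_covector//; exact: ex_derive.
- by under eq_fun do rewrite dual_coord_covector//; exact: ex_derive.
have -> : partial X j (fun xi => ftransform (-1) Gs (dual_coord X xi)) xi =
    ftransform (-1) (fun v => 'i * (-1 * v 0 j)%:C * Gs v) (dual_coord X xi).
  rewrite /partial.
  have -> : (fun v => Re (ftransform (-1) Gs (dual_coord X (cov v)))) =
      (fun w => Re (ftransform (-1) Gs w)).
    by apply/funext => v; rewrite dual_coord_covector.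
  have -> : (fun v => Im (ftransform (-1) Gs (dual_coord X (cov v)))) =
      (fun w => Im (ftransform (-1) Gs w)).
    by apply/funext => v; rewrite dual_coord_covector.
  apply: complex_eq; first exact: (@derive_val _ _ _ _ _ _ _ dR).
  exact: (@derive_val _ _ _ _ _ _ _ dI).
rewrite mulrCA; congr (_ * _).
have -> : (fun v => 'i * (-1 * v 0 j)%:C * Gs v) =
    (fun v => - 'i * ((monomial v (unit_multi j))%:C * Gs v)).
  by apply/funext => v; rewrite monomial_unit mulN1r rmorphN mulrN !mulNr -mulrA.
by rewrite ftransformZ// mulrA mulrN -expr2 sqr_i opprK mul1r.
Qed.

Lemma Dmulti_ftransform (c : R[i]) (G : 'rV[R]_d -> R[i])
    (a : {ffun 'I_d -> nat}) : crapid G ->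
  Dmulti X a (fun xi => c * ftransform (-1) G (dual_coord X xi)) =
  fun xi => c * ftransform (-1) (fun v => (monomial v a)%:C * G v) (dual_coord X xi).
Proof.
move=> cG; rewrite /Dmulti multi_iter_block_word foldr_Dpart_ftransform//.
have -> // : (fun v => (\prod_(j <- block_word a (enum 'I_d)) v 0 j)%:C * G v) =
    (fun v => (monomial v a)%:C * G v).
by apply/funext => v; rewrite prod_block_word.
Qed.

End Dual.

(** * Derivatives of twisted products *)

(** The twisted product, expressed through the inverse transforms F and H of
    its factors, up to a constant that depends only on the measures.  The
    hypotheses bear on F and H, so that the formula also applies to
    derivatives of Schwartz functions. *)
Lemma sharpE (R : realType) (g : vectType R) (d : nat) (X : d.-tuple g)
    (br : g -> g -> g) (cx cxi : R) (f h : dual g -> R[i])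
    (F H : 'rV[R]_d -> R[i]) (xi : dual g) :
  basis_of fullv X -> lie_bracket br -> two_step br ->
  ftransform 1 (fun v => f (covector X v)) = F ->
  ftransform 1 (fun v => h (covector X v)) = H ->
  crapid F -> crapid H ->
  sharp X br cx cxi f h xi =
  (cx * cx * cxi * cxi)%:C * ftransform (-1) (coord_conv X br F H) (dual_coord X xi).
Proof.
move=> X_basis br_lie br_two_step FE HE cF cH; rewrite /sharp /fourier /integral_alg.
have convE x : convolution X br cx (inv_fourier X cxi f) (inv_fourier X cxi h)
    (Defs.point X x) = (cx * cxi * cxi)%:C * coord_conv X br F H x.
  rewrite /convolution /integral_alg /coord_conv.
  rewrite [X in _ * X](_ : _ = (cxi * cxi)%:C * coord_conv X br F H x).
    by rewrite !rmorphM !mulrA.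
  rewrite /coord_conv -cintegralZ; last exact/crapid_integrable/crapid_convolute.
  congr cintegral; apply/funext => y.
  by rewrite -point_rdiv_coord// !inv_fourier_point// FE HE rmorphM mulrACA.
rewrite [X in _ * X](_ : _ = (cx * cxi * cxi)%:C *
    ftransform (-1) (coord_conv X br F H) (dual_coord X xi)).
  by rewrite !rmorphM !mulrA.
rewrite -ftransformZ; last exact: crapid_coord_conv.
congr cintegral; apply/funext => x.
by rewrite convE dual_point// mulN1r.
Qed.

Theorem corollary3p17 (R : realType) (g : vectType R) (d : nat)
    (X : d.-tuple g) (br : g -> g -> g) (delta : R -> 'End(g)) (cx cxi : R)
    (X_basis : basis_of fullv X)
    (br_lie : lie_bracket br)
    (br_two_step : two_step br)
    (delta_dil : two_step_dilations br delta)
    (cx_gt0 : 0 < cx) (cxi_gt0 : 0 < cxi)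
    (* Fourier inversion with the measures cx dx and cxi dxi *)
    (normalization : cx * cxi * (2 * pi) ^+ d = 1)
    (alpha : {ffun 'I_d -> nat}) (f h : dual g -> R[i])
    (f_schwartz : schwartz X f) (h_schwartz : schwartz X h) (xi : dual g) :
  Dmulti X alpha (sharp X br cx cxi f h) xi =
  \sum_(p \in @decompositions R g d X br alpha)
    (let: (beta, gamma, sigma) := p in
     (multi_binom alpha beta sigma * c_sigma sigma)%:C *
     sharp X br cx cxi (Dmulti X (beta + sigma1 sigma) f)
                       (Dmulti X (gamma + sigma2 sigma) h) xi).
Proof.
have cF := crapid_ftransform X_basis f_schwartz.
have cH := crapid_ftransform X_basis h_schwartz.
set F := ftransform 1 _ in cF; set H := ftransform 1 _ in cH.
pose K : R[i] := (cx * cx * cxi * cxi)%:C.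
have DF b : ftransform 1 (fun v => Dmulti X b f (covector X v)) =
    (fun w => (monomial w b)%:C * F w).
  by apply/funext => w; rewrite ftransform_Dmulti.
have DH b : ftransform 1 (fun v => Dmulti X b h (covector X v)) =
    (fun w => (monomial w b)%:C * H w).
  by apply/funext => w; rewrite ftransform_Dmulti.
pose C (p : {ffun 'I_d -> nat} * {ffun 'I_d -> nat} * {ffun triples X br -> nat}) :=
  coord_conv X br (fun w => (monomial w (p.1.1 + sigma1 p.2))%:C * F w)
             (fun w => (monomial w (p.1.2 + sigma2 p.2))%:C * H w).
have cC p : crapid (C p).
  by apply: crapid_coord_conv => //; exact: crapid_monomialM.
rewrite fsbig_finite; last exact: decompositions_finite.
transitivity (K * ftransform (-1)
    (fun v => (monomial v alpha)%:C * coord_conv X br F H v) (dual_coord X xi)).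
  have -> : sharp X br cx cxi f h =
      fun xi => K * ftransform (-1) (coord_conv X br F H) (dual_coord X xi).
    by apply/funext => xi';
      exact: sharpE X_basis br_lie br_two_step erefl erefl cF cH.
  have DS := Dmulti_ftransform X_basis K alpha
    (crapid_coord_conv X_basis br_lie br_two_step cF cH).
  have DSx := congr1 (fun q => q xi) DS.
  exact: DSx.
transitivity (K * \sum_(p <- finmap.enum_fset (fset_set (@decompositions R g d X br alpha)))
    (multi_binom alpha p.1.1 p.2 * c_sigma p.2)%:C * ftransform (-1) (C p) (dual_coord X xi)).
  congr (_ * _); rewrite /ftransform.
  have [_ <-] := cintegral_sum
    (finmap.enum_fset (fset_set (@decompositions R g d X br alpha)))
    (fun p => (multi_binom alpha p.1.1 p.2 * c_sigma p.2)%:C)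
    (fun p => crapid_cexpi (-1) (dual_coord X xi) (cC p)).
  congr cintegral; apply/funext => v.
  rewrite monomial_coord_conv// mulr_sumr; apply: eq_bigr => p _.
  by rewrite mulrCA.
rewrite mulr_sumr; apply: eq_bigr => -[[b c] s] _.
rewrite (sharpE cx cxi xi X_basis br_lie br_two_step (DF _) (DH _)
  (crapid_monomialM _ cF) (crapid_monomialM _ cH)).
by rewrite mulrCA.
Qed.
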